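(* For every real $d\ge 1$ there exists $0<H^*(d)<\infty$ such that for every soft constraint model with $\|H\|\le H^*(d)$ the following holds. Let $G$ be a random graph distributed as $G(n,d/n)$. Then there is a constant $C<\infty$ not depending on $n$ such that, with high probability (i.e. with probability tending to $1$ as $n\to\infty$), the mixing time of the Gibbs sampler of the model on $G$ is $O(n^{C})$.
   Context: $G(n,p)$ is the Erdős–Rényi random graph on $n$ vertices in which each potential edge is present independently with probability $p$. Soft constraint model: let $\mathcal C$ be a finite set of states, $h:\mathcal C\to\mathbb R$ (activity function) and $g:\mathcal C^2\to\mathbb R$ a symmetric function (interaction function, taking only finite values). On a finite graph $G=(V,E)$ the Hamiltonian is $H(\sigma)=\sum_{u\in V}h(\sigma(u))+\sum_{(u,v)\in E}g(\sigma(u),\sigma(v))$ for $\sigma\in\mathcal C^V$, and the model is the probability distribution $P(\sigma)=\frac1Z\exp(H(\sigma))$ on $\mathcal C^V$. The norm is $\|H\|=\max\{\max_{x}|h(x)|,\max_{x,y}|g(x,y)|\}$. Gibbs sampler: the discrete time Markov chain on $\mathcal C^V$ in which, from the current configuration $\sigma$, a vertex $v\in V$ is chosen uniformly at random, $\sigma(w)$ is kept for all $w\ne v$, and the new value at $v$ is $x\in\mathcal C$ with probability proportional to $\exp\big(h(x)+\sum_{w:(v,w)\in E}g(\sigma(w),x)\big)$. The mixing time is the number of steps needed to guarantee that the chain, started from an arbitrary state, is within total variation distance $(2e)^{-1}$ of the stationary distribution. The constant implied in $O(n^C)$ does not depend on $n$ or on the realization of the graph. *)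

(* Defs.v *)
From HB Require Import structures.
From mathcomp Require Import all_boot all_order all_algebra.
From mathcomp Require Import all_classical all_reals all_analysis.

Set Implicit Arguments.
Unset Strict Implicit.
Unset Printing Implicit Defensive.

Import Order.TTheory GRing.Theory Num.Theory.
Import numFieldNormedType.Exports.

Local Open Scope ring_scope.

(* An unordered pair {u, v} of distinct vertices is encoded by the ordered
   pair (u, v) with u < v, so that [{set edge n}] is exactly the type of simple
   graphs on n labelled vertices and each edge is counted once in sums. *)
Definition edge (n : nat) := {e : 'I_n * 'I_n | (e.1 < e.2)%N}.

Definition graph (n : nat) := {set edge n}.

Definition adj (n : nat) (G : graph n) (u v : 'I_n) : bool :=
  [exists e in G, (val e == (u, v)) || (val e == (v, u))].

(* The product over all potential edges expresses their independence.  This is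
   a probability only when 0 <= p <= 1; for p = d / n this excludes finitely
   many n. *)
Definition Gnp_mass (R : realType) (n : nat) (p : R) (G : graph n) : R :=
  \prod_(e : edge n) (if e \in G then p else 1 - p).

Definition Gnp_prob (R : realType) (n : nat) (p : R) (A : pred (graph n)) : R :=
  \sum_(G : graph n | A G) Gnp_mass p G.

Record soft_model (R : realType) := SoftModel {
  state : finType;
  activity : state -> R;
  interaction : state -> state -> R;
  interaction_sym : forall x y, interaction x y = interaction y x
}.

(* The maxima are over nonnegative reals, so starting them at 0 is harmless. *)
Definition model_norm (R : realType) (M : soft_model R) : R :=
  Num.max (\big[Num.max/0]_(x : state M) `|activity x|)
          (\big[Num.max/0]_(x : state M)
             \big[Num.max/0]_(y : state M) `|interaction x y|).

Section Gibbs.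
Variables (R : realType) (M : soft_model R) (n : nat) (G : graph n).

Definition config := {ffun 'I_n -> state M}.

Definition hamiltonian (sigma : config) : R :=
  \sum_(u : 'I_n) activity (sigma u) +
  \sum_(e in G) interaction (sigma (val e).1) (sigma (val e).2).

Definition partition_function : R :=
  \sum_(sigma : config) expR (hamiltonian sigma).

Definition gibbs_measure (sigma : config) : R :=
  expR (hamiltonian sigma) / partition_function.

Definition local_weight (sigma : config) (v : 'I_n) (x : state M) : R :=
  expR (activity x + \sum_(w | adj G v w) interaction (sigma w) x).

Definition update (sigma : config) (v : 'I_n) (x : state M) : config :=
  [ffun w => if w == v then x else sigma w].

Definition gibbs_step (sigma tau : config) : R :=
  \sum_(v : 'I_n) n%:R^-1 *
    \sum_(x : state M | update sigma v x == tau)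
      local_weight sigma v x / \sum_(y : state M) local_weight sigma v y.

Fixpoint gibbs_law (t : nat) (sigma tau : config) : R :=
  if t is t'.+1 then
    \sum_(rho : config) gibbs_law t' sigma rho * gibbs_step rho tau
  else (sigma == tau)%:R.

Definition tv_dist (mu nu : config -> R) : R :=
  2^-1 * \sum_(sigma : config) `|mu sigma - nu sigma|.

(* The infimum is +oo if no number of steps suffices; otherwise it is the least
   such number. *)
Definition mixing_time : \bar R :=
  ereal_inf [set (t%:R : R)%:E | t in [set t : nat |
    forall sigma : config,
      tv_dist (gibbs_law t sigma) gibbs_measure <= (2 * expR 1)^-1]].

End Gibbs.

(* Main.v *)
Require Import Defs.
From HB Require Import structures.
From mathcomp Require Import all_boot all_order all_algebra.
From mathcomp Require Import all_classical all_reals all_analysis.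
From mathcomp Require Import ring lra.
From mathcomp Require Import fintype finset.

(** Call the sum over all trees [T] of [G] containing [v] of
    [eps ^ (size T - 1) * kap ^ (number of edges of G spanned by T)] the tree
    sum of [v].  Its expectation in [G(n, d/n)] is bounded once [eps] is small,
    so with high probability all tree sums are at most [n^2].  On such a graph:

    - Exploring the disagreements caused by one spin edge by edge dominates them
      by a percolation cluster with edge probability [O(norm H)], whose expected
      size is logarithmic by the bound on tree sums, whatever spins are pinned.
    - Hence revealing the spin at a uniformly random vertex lowers the expected
      conditional variance of [f] by a factor at least [1 - O(log n / n)].
      After [b * n] such steps only a polynomial factor of the variance is lost.
    - The vertices still hidden have density about [exp (- b)], so they form
      small components.  On a component [T] the model is within a factor
      exponential in its number of edges of a product measure (Holley--Stroock);
      averaging these factors over the hidden set is again a tree sum.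

    This gives a Poincare inequality for the Gibbs sampler with a polynomial
    constant, hence polynomial mixing. *)

Set Implicit Arguments.
Unset Strict Implicit.
Unset Printing Implicit Defensive.

Import Order.TTheory GRing.Theory Num.Theory.
Import numFieldNormedType.Exports.

Local Open Scope ring_scope.

(** * Conditional expectations of finite weighted configurations *)

Section CondExp.
Variables (R : realType) (I X : finType).
Local Notation conf := {ffun I -> X}.
Implicit Types (L T : {set I}) (s t r : conf) (f g : conf -> R).

Definition agree L s t := [forall i in L, s i == t i].

Lemma agreeP L s t : reflect {in L, s =1 t} (agree L s t).
Proof.
apply: (iffP forall_inP) => H i /H; first by move/eqP.
by move=> ->.
Qed.

Lemma agree_refl L s : agree L s s.
Proof. exact/agreeP. Qed.

Lemma agree_sym L s t : agree L s t = agree L t s.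
Proof. by apply/agreeP/agreeP => H i /H. Qed.

Lemma agree_trans L s t r : agree L s t -> agree L t r -> agree L s r.
Proof. by move=> /agreeP st /agreeP tr; apply/agreeP => i iL; rewrite st ?tr. Qed.

Lemma agree_eql L s t : agree L s t -> agree L s =1 agree L t.
Proof.
move=> st r; apply/idP/idP; last exact: agree_trans.
by apply: agree_trans; rewrite agree_sym.
Qed.

Lemma agree_sub L L' s t : L \subset L' -> agree L' s t -> agree L s t.
Proof. by move=> /subsetP LL' /agreeP st; apply/agreeP => i /LL' /st. Qed.

Lemma agree0 s t : agree set0 s t.
Proof. by apply/agreeP => i; rewrite inE. Qed.

(** Measurability with respect to the coordinates in [L]; the atoms are the classes of [agree L]. *)
Definition meas L f := forall s t, agree L s t -> f s = f t.

Lemma meas_sub L L' f : L \subset L' -> meas L f -> meas L' f.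
Proof. by move=> LL' mf s t /(agree_sub LL') /mf. Qed.

Variable w : conf -> R.
Hypothesis w_gt0 : forall s, 0 < w s.

Definition cmass L s : R := \sum_(t | agree L s t) w t.

Definition cexp L f s : R := (\sum_(t | agree L s t) w t * f t) / cmass L s.

Definition dot f g : R := \sum_s w s * f s * g s.

(** Since [w] is not normalized, this is the expected conditional variance given the coordinates in
    [L], times the total mass of [w]. *)
Definition dv L f : R := dot (fun s => f s - cexp L f s) (fun s => f s - cexp L f s).

Lemma cmass_gt0 L s : 0 < cmass L s.
Proof.
rewrite /cmass (bigD1 s) ?agree_refl //=.
by rewrite ltr_pwDl ?sumr_ge0 // => t _; apply: ltW.
Qed.

Lemma meas_cmass L : meas L (cmass L).
Proof. by move=> s t st; apply: eq_bigl; apply: agree_eql. Qed.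

Lemma meas_cexp L f : meas L (cexp L f).
Proof.
move=> s t st; rewrite /cexp (meas_cmass st); congr (_ / _).
by apply: eq_bigl; apply: agree_eql.
Qed.

Lemma eq_cexp L f g : f =1 g -> cexp L f =1 cexp L g.
Proof. by move=> fg s; rewrite /cexp; under eq_bigr do rewrite fg. Qed.

Lemma cexp_meas L f : meas L f -> cexp L f =1 f.
Proof.
move=> mf s; rewrite /cexp (eq_bigr (fun t => w t * f s)); last first.
  by move=> t st; rewrite (mf _ _ st).
by rewrite -mulr_suml mulrAC divff ?mul1r // gt_eqF // cmass_gt0.
Qed.

Lemma cexpD L f g s : cexp L (fun t => f t + g t) s = cexp L f s + cexp L g s.
Proof.
rewrite /cexp -mulrDl -big_split; congr (_ / _).
by apply: eq_bigr => t _; rewrite mulrDr.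
Qed.

Lemma cexpB L f g s : cexp L (fun t => f t - g t) s = cexp L f s - cexp L g s.
Proof.
rewrite /cexp -mulrBl -sumrB; congr (_ / _).
by apply: eq_bigr => t _; rewrite mulrBr.
Qed.

Lemma cexp_norm_le L f s b : (forall t, agree L s t -> `|f t| <= b) ->
  `|cexp L f s| <= b.
Proof.
move=> fb; have Z := cmass_gt0 L s.
rewrite normrM normfV (gtr0_norm Z) ler_pdivrMr // mulr_sumr.
apply: le_trans (ler_norm_sum _ _ _) _; apply: ler_sum => t st.
by rewrite normrM gtr0_norm // mulrC ler_pM2r // fb.
Qed.

Lemma dotC f g : dot f g = dot g f.
Proof. by apply: eq_bigr => s _; rewrite mulrAC. Qed.

Lemma eq_dot f f' g g' : f =1 f' -> g =1 g' -> dot f g = dot f' g'.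
Proof. by move=> ff' gg'; apply: eq_bigr => s _; rewrite ff' gg'. Qed.

Lemma dotBr f g h : dot f (fun s => g s - h s) = dot f g - dot f h.
Proof. by rewrite /dot -sumrB; apply: eq_bigr => s _; rewrite mulrBr. Qed.

Lemma dotBl f g h : dot (fun s => g s - h s) f = dot g f - dot h f.
Proof. by rewrite dotC dotBr !(dotC f). Qed.

Lemma dot_ge0 f : 0 <= dot f f.
Proof.
by apply: sumr_ge0 => s _; rewrite -mulrA mulr_ge0 ?(ltW (w_gt0 _)) // -expr2 sqr_ge0.
Qed.

(** After the two sums are exchanged, [g] and [cmass] are constant on the class of [t], whose
    weights add up to [cmass L t]. *)
Lemma dot_cexpl L f g : meas L g -> dot (cexp L f) g = dot f g.
Proof.
move=> mg; rewrite /dot.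
transitivity (\sum_s \sum_(t | agree L s t) w t * f t * (w s * g s / cmass L s)).
  by apply: eq_bigr => s _; rewrite -mulr_suml /cexp; ring.
rewrite (exchange_big_dep predT) //=; apply: eq_bigr => t _.
transitivity (\sum_(s | agree L t s) w s * (g t * (w t * f t) / cmass L t)).
  rewrite (eq_bigl (agree L t)); last by move=> s; rewrite agree_sym.
  by apply: eq_bigr => s st; rewrite (mg _ _ st) (meas_cmass st); ring.
rewrite -mulr_suml -/(cmass L t) mulrCA divff ?mulr1 ?gt_eqF ?cmass_gt0 //.
by rewrite mulrC.
Qed.

(** The indicator of the [L]-class of [s] depends only on the coordinates in [L'], so together with
    [c] it is a test function for [dot_cexpl]. *)
Lemma sum_cexp L L' f c s : L \subset L' -> meas L' c ->
  \sum_(t | agree L s t) w t * c t * cexp L' f t =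
  \sum_(t | agree L s t) w t * c t * f t.
Proof.
move=> LL' mc; pose g t := c t *+ agree L s t.
have mg : meas L' g.
  move=> t r tr; rewrite /g (mc _ _ tr); congr (_ *+ nat_of_bool _).
  rewrite agree_sym (agree_eql (agree_sub LL' tr)) agree_sym //.
have E h : \sum_(t | agree L s t) w t * c t * h t = dot h g.
  rewrite big_mkcond; apply: eq_bigr => t _; rewrite /g.
  by case: ifP => _; rewrite ?mulr0n ?mulr0 // mulr1n mulrAC.
by rewrite !E dot_cexpl.
Qed.

Lemma sum_cexp1 L L' f s : L \subset L' ->
  \sum_(t | agree L s t) w t * cexp L' f t = \sum_(t | agree L s t) w t * f t.
Proof.
move=> LL'; have := @sum_cexp L L' f (fun=> 1) s LL' (fun _ _ _ => erefl).
by under eq_bigr do rewrite mulr1; under [in RHS]eq_bigr do rewrite mulr1.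
Qed.

Lemma cexp_tower L L' f : L \subset L' -> cexp L (cexp L' f) =1 cexp L f.
Proof. by move=> LL' s; rewrite /cexp sum_cexp1. Qed.

Lemma dot_cexp2 L f : dot (cexp L f) (cexp L f) = dot f (cexp L f).
Proof. by rewrite dot_cexpl //; apply: meas_cexp. Qed.

Lemma dvE L f : dv L f = dot f f - dot (cexp L f) (cexp L f).
Proof.
rewrite /dv dotBl !dotBr (dotC _ f).
have <- : dot f (cexp L f) = dot (cexp L f) (cexp L f) by rewrite dot_cexp2.
ring.
Qed.

Lemma dv_ge0 L f : 0 <= dv L f.
Proof. exact: dot_ge0. Qed.

Lemma dot_cexp_le L f : dot (cexp L f) (cexp L f) <= dot f f.
Proof. by rewrite -subr_ge0 -dvE dv_ge0. Qed.

Lemma dv_min L f g : meas L g ->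
  dv L f <= dot (fun s => f s - g s) (fun s => f s - g s).
Proof.
move=> mg; rewrite dvE !(dotBl, dotBr).
have -> : dot f g = dot (cexp L f) g by rewrite dot_cexpl.
have := dot_ge0 (fun s => cexp L f s - g s); rewrite !(dotBl, dotBr).
rewrite (dotC g) (dotC g f) -(dot_cexpl f mg); lra.
Qed.

(* [cexp (~: T)] resamples the coordinates in [T]; the hypotheses say that
   resampling [T] and resampling [T'] are conditionally independent. *)
Lemma dv_tensor T T' f :
  (forall g, meas (~: T) g -> cexp (~: T') g =1 cexp (~: (T :|: T')) g) ->
  (forall g, meas (~: T') g -> cexp (~: T) g =1 cexp (~: (T :|: T')) g) ->
  dv (~: (T :|: T')) f <= dv (~: T) f + dv (~: T') f.
Proof.
move=> H1 H2; set S := T :|: T'.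
set P := cexp (~: T); set Q := cexp (~: T').
have sT : ~: S \subset ~: T by rewrite setCS subsetUl.
have sT' : ~: S \subset ~: T' by rewrite setCS subsetUr.
have QP : Q (P f) =1 cexp (~: S) f.
  by move=> s; rewrite /Q H1 ?cexp_tower //; apply: meas_cexp.
have PQ : P (Q f) =1 cexp (~: S) f.
  by move=> s; rewrite /P H2 ?cexp_tower //; apply: meas_cexp.
have A : dv (~: T') (P f) <= dv (~: T') f.
  apply: le_trans (dv_min (P f) (g := cexp (~: S) f) _) _.
    exact: meas_sub (@meas_cexp _ f).
  rewrite /dv -/Q; set h := fun s => f s - Q f s.
  rewrite -(@eq_dot (P h) _ (P h)); first exact: dot_cexp_le.
  - by move=> s; rewrite /P /h cexpB -/P PQ.
  - by move=> s; rewrite /P /h cexpB -/P PQ.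
(* Pythagoras along [f], [P f], [Q (P f)], the last being the expectation given [~: S]. *)
move: A; rewrite !dvE -/P -/Q (eq_dot QP QP); lra.
Qed.

End CondExp.

(** * From influence bounds to variance decay *)

(** The successive ratios of a log-convex sequence do not decrease, so a first ratio above [eta]
    would force growth faster than [C * eta ^+ k]. *)
Lemma logconvex_ratio (R : realType) (a : nat -> R) (C eta : R) :
  0 < eta -> (forall k, 0 <= a k) ->
  (forall k, a k.+1 ^+ 2 <= a k * a k.+2) ->
  (forall k, a k <= C * eta ^+ k) -> a 1%N <= eta * a 0%N.
Proof.
move=> eta0 a0 lc aC; rewrite leNgt; apply/negP => H.
have a00 : 0 < a 0%N.
  rewrite lt0r a0 andbT; apply/eqP => E.
  have := lc 0%N; have := H; rewrite E mulr0 mul0r => a1 le0.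
  by have := exprn_gt0 2 a1; rewrite ltNge le0.
pose r := a 1%N / a 0%N.
have r_eta : eta < r by rewrite /r ltr_pdivlMr.
have r0 : 0 < r by apply: lt_trans r_eta.
have step k : 0 < a k /\ r * a k <= a k.+1.
  elim: k => [|k [ak IH]].
    by split=> //; rewrite /r divfK // gt_eqF.
  have ak1 : 0 < a k.+1 by apply: lt_le_trans IH; rewrite mulr_gt0.
  split=> //; rewrite -(ler_pM2l ak).
  apply: le_trans (lc k); rewrite expr2 mulrCA mulrA ler_pM2r //.
have geo k : r ^+ k * a 0%N <= a k.
  elim: k => [|k IH]; first by rewrite mul1r.
  by apply: le_trans (proj2 (step k)); rewrite exprS -mulrA ler_pM2l.
have bd k : (r / eta) ^+ k * a 0%N <= C.
  rewrite expr_div_n mulrAC ler_pdivrMr ?exprn_gt0 //.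
  exact: le_trans (geo k) (aC k).
pose x := r / eta - 1.
have x0 : 0 < x by rewrite /x subr_gt0 ltr_pdivlMr ?mul1r.
have bern k : 1 + k%:R * x <= (r / eta) ^+ k.
  have -> : r / eta = 1 + x by rewrite /x; ring.
  elim: k => [|k IH]; first by rewrite mul0r addr0.
  rewrite exprS -natr1.
  apply: le_trans (_ : (1 + x) * (1 + k%:R * x) <= _); last first.
    by rewrite ler_pM2l //; lra.
  have : 0 <= k%:R * x * x by rewrite !mulr_ge0 ?ler0n ?(ltW x0).
  lra.
(* By Bernoulli's inequality [(r / eta) ^+ k] grows at least linearly; at [N.+1] its product with
   [a 0] exceeds [C]. *)
pose N := Num.truncn (C / (x * a 0%N)).
have xa : 0 < x * a 0%N by rewrite mulr_gt0.
have := truncnS_gt (C / (x * a 0%N)); rewrite -/N ltr_pdivrMr // => CN.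
have := bd N.+1; apply/negP; rewrite -ltNge; apply: lt_le_trans CN _.
rewrite mulrA ler_pM2r //; apply: le_trans (bern _).
by rewrite lerDr.
Qed.

Section Contraction.
Variables (R : realType) (I X : finType) (w : {ffun I -> X} -> R).
Local Notation conf := {ffun I -> X}.
Hypothesis w_gt0 : forall s, 0 < w s.
Implicit Types (L : {set I}) (s t : conf) (f g : conf -> R).

Definition diffs s t := [set i | s i != t i].

Definition lip L (l : R) f := forall s t, agree L s t -> `|f s - f t| <= l * #|diffs s t|%:R.

Variables (L : {set I}) (eta : R).
Hypothesis eta_gt0 : 0 < eta.
(** Beyond the common part on [L], the two expectations see only the spin at [u]: this bounds the
    total influence of a single vertex. *)
Hypothesis influence : forall f l u s t, 0 <= l -> lip L l f -> agree L s t ->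
  u \notin L -> `|cexp w (u |: L) f s - cexp w (u |: L) f t| <= eta * l.

Let B f s := \sum_u cexp w (u |: L) f s.

Let lip_B f l : 0 <= l -> lip L l f -> lip L (eta * l) (B f).
Proof.
move=> l0 lf s t st; rewrite /B -sumrB.
apply: le_trans (ler_norm_sum _ _ _) _.
(* The terms with [s u = t u] cancel, so only the disagreements contribute, each at most
   [eta * l]. *)
rewrite (bigID (mem (diffs s t))) /= [X in _ + X]big1 ?addr0; last first.
  move=> u; rewrite inE negbK => /eqP sut; apply/eqP; rewrite normr_eq0 subr_eq0.
  apply/eqP/meas_cexp/agreeP => i; rewrite in_setU1 => /orP[/eqP-> //|].
  exact: (elimT (agreeP _ _ _) st).
rewrite mulrC mulr_natl -sumr_const; apply: ler_sum => u; rewrite inE => sut.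
apply: influence => //; apply: contra sut => uL.
by apply/eqP; apply: (elimT (agreeP _ _ _) st).
Qed.

Let dot_B f g : dot w (B f) g = dot w f (B g).
Proof.
have E h k : dot w (B h) k = \sum_u dot w (cexp w (u |: L) h) k.
  rewrite /dot exchange_big; apply: eq_bigr => s _.
  by rewrite /B mulr_sumr mulr_suml.
rewrite E dotC E; apply: eq_bigr => u _.
have D h k : dot w (cexp w (u |: L) h) k = dot w (cexp w (u |: L) h) (cexp w (u |: L) k).
  rewrite [RHS]dotC [RHS](dot_cexpl w_gt0 (L := u |: L)); last exact: meas_cexp.
  exact: dotC.
by rewrite D [RHS]D dotC.
Qed.

Let B_mean0 f : cexp w L f =1 (fun=> 0) -> cexp w L (B f) =1 (fun=> 0).
Proof.
move=> f0 s.
have cexp_sum (F : I -> conf -> R) (r : seq I) :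
    cexp w L (fun t => \sum_(u <- r) F u t) s = \sum_(u <- r) cexp w L (F u) s.
  elim: r => [|u r IH].
    rewrite big_nil (eq_cexp _ _ (g := fun=> 0)) ?cexp_meas // => t.
    by rewrite big_nil.
  rewrite big_cons -IH -cexpD; apply: eq_cexp => t; by rewrite big_cons.
rewrite /B cexp_sum big1 // => u _.
by rewrite cexp_tower ?f0 // subsetU1.
Qed.

Lemma cauchy_schwarz_dot f g : dot w f g ^+ 2 <= dot w f f * dot w g g.
Proof.
have ff := dot_ge0 w_gt0 f; have gg := dot_ge0 w_gt0 g.
have [g0|g0] := eqVneq (dot w g g) 0.
  have gz s : g s = 0.
    apply/eqP; have /eqP := g0; rewrite psumr_eq0 => [/allP /(_ s)|t _].
      rewrite mem_index_enum => /(_ isT); rewrite -mulrA mulf_eq0 gt_eqF //=.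
      by rewrite mulf_eq0 orbb.
    by rewrite -mulrA mulr_ge0 ?(ltW (w_gt0 _)) // -expr2 sqr_ge0.
  rewrite /dot (eq_bigr (fun=> 0)) => [|s _]; last by rewrite gz mulr0.
  by rewrite big1 // expr0n /= mulr_ge0.
have gp : 0 < dot w g g by rewrite lt0r g0.
pose c := dot w f g / dot w g g.
have := dot_ge0 w_gt0 (fun s => f s - c * g s).
rewrite dotBl !dotBr.
have Z h k : dot w h (fun s => c * k s) = c * dot w h k.
  by rewrite /dot mulr_sumr; apply: eq_bigr => s _; ring.
have Zl h k : dot w (fun s => c * k s) h = c * dot w k h.
  by rewrite dotC Z dotC.
rewrite -ler_pdivrMr // !Z !Zl (dotC w g f).
have cE : c * dot w g g = dot w f g by rewrite /c divfK.
rewrite cE expr2 -mulrA -/c; nra.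
Qed.

(* [B] is self-adjoint and multiplies Lipschitz constants by at most [eta]; since
   [k |-> dot (B^k f) (B^k f)] is log-convex, this bounds [B] by [eta] in L2. *)
Lemma contraction_dv f :
  \sum_u (dv w L f - dv w (u |: L) f) <= eta * dv w L f.
Proof.
pose f0 s := f s - cexp w L f s.
have f0m : cexp w L f0 =1 (fun=> 0).
  by move=> s; rewrite /f0 cexpB cexp_tower // subrr.
have dvL : dv w L f = dot w f0 f0 by [].
have dvu u : dv w (u |: L) f = dv w (u |: L) f0.
  apply: eq_dot => s; rewrite /f0 cexpB (cexp_meas w_gt0 (f := cexp w L f));
    by [ring | apply: meas_sub (@meas_cexp _ _ _ w _ f); apply: subsetU1].
(* By Pythagoras each drop of variance is the squared norm of [cexp w (u |: L) f0]. *)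
have -> : \sum_u (dv w L f - dv w (u |: L) f) = dot w (B f0) f0.
  rewrite /dot /B; under [RHS]eq_bigr do rewrite mulr_sumr mulr_suml.
  rewrite exchange_big; apply: eq_bigr => u _.
  by rewrite dvu dvL (dvE w_gt0) opprB addrC subrK (dot_cexp2 w_gt0) dotC.
(* A crude Lipschitz constant suffices, because only the exponential rate in [k] matters in
   [logconvex_ratio]. *)
pose l0 := \sum_s 2 * `|f0 s|.
have l00 : 0 <= l0 by apply: sumr_ge0 => s _; rewrite mulr_ge0.
have lip0 : lip L l0 f0.
  move=> s t _; have [->|st] := eqVneq s t.
    by rewrite subrr normr0 mulr_ge0.
  apply: le_trans (_ : l0 * 1 <= _); last first.
    rewrite ler_wpM2l // ler1n card_gt0; apply: contra st => /eqP D.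
    by apply/eqP/ffunP => i; have := in_set0 i; rewrite -D inE => /negbFE/eqP.
  have le u : 2 * `|f0 u| <= l0.
    by rewrite /l0 (bigD1 u) //= lerDl sumr_ge0 // => v _; rewrite mulr_ge0.
  rewrite mulr1; apply: le_trans (ler_normB _ _) _; move: (le s) (le t); lra.
pose b k := iter k B f0.
have bP k : lip L (eta ^+ k * l0) (b k) /\ cexp w L (b k) =1 fun=> 0.
  elim: k => [|k [IH1 IH2]]; first by rewrite mul1r.
  split; last exact: B_mean0.
  by rewrite exprS -mulrA; apply: lip_B => //; rewrite mulr_ge0 ?exprn_ge0 ?(ltW eta_gt0).
(* A function of conditional mean zero is bounded by its oscillation, hence by its Lipschitz
   constant times the number of sites. *)
have bB k s : `|b k s| <= eta ^+ k * l0 * #|I|%:R.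
  have -> : b k s = - cexp w L (fun t => b k t - b k s) s.
    by rewrite cexpB (proj2 (bP k)) (cexp_meas w_gt0 (f := fun=> b k s)) // sub0r opprK.
  rewrite normrN; apply: cexp_norm_le => // t st.
  rewrite distrC; apply: le_trans ((proj1 (bP k)) _ _ st) _.
  by rewrite ler_wpM2l ?mulr_ge0 ?exprn_ge0 ?(ltW eta_gt0) // ler_nat max_card.
pose a k := dot w (b k) (b k).
have a1 : a 1%N <= eta ^+ 2 * a 0%N.
  apply: (@logconvex_ratio _ a (\sum_s w s * (l0 * #|I|%:R) ^+ 2)).
  - by rewrite exprn_gt0.
  - by move=> k; apply: dot_ge0.
  - move=> k; rewrite {1}/a; have -> : dot w (b k.+1) (b k.+1) = dot w (b k) (b k.+2).
      exact: dot_B (b k) (b k.+1).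
    exact: cauchy_schwarz_dot.
  - move=> k; rewrite /a /dot mulr_suml; apply: ler_sum => s _.
    have H : b k s ^+ 2 <= (eta ^+ k * l0 * #|I|%:R) ^+ 2.
      by rewrite -(real_normK (num_real (b k s))) lerXn2r ?nnegrE //
        !mulr_ge0 ?exprn_ge0 ?(ltW eta_gt0).
    rewrite -[leLHS]mulrA -[leRHS]mulrA ler_pM2l // -expr2; apply: le_trans H _.
    rewrite -mulrA exprMn -!exprM. by rewrite (mulnC k) mulrC.
rewrite dvL -ler_sqr ?nnegrE ?(mulr_ge0 (ltW _)) ?dot_ge0 //; last first.
  rewrite /dot /B; under eq_bigr do rewrite mulr_sumr mulr_suml.
  rewrite exchange_big sumr_ge0 // => u _.
  by rewrite -/(dot w (cexp w (u |: L) f0) f0) dotC -dot_cexp2 ?dot_ge0.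
apply: le_trans (cauchy_schwarz_dot _ _) _.
by rewrite exprMn expr2 mulrA ler_wpM2r ?dot_ge0.
Qed.
End Contraction.

(** * Rooted forests *)

Lemma ler_sum_inj (R : realType) (S T : finType) (P : pred S) (Q : pred T)
    (F : S -> R) (G : T -> R) (h : S -> T) :
  {in P &, injective h} -> (forall x, P x -> Q (h x) /\ F x <= G (h x)) ->
  (forall y, Q y -> 0 <= G y) -> \sum_(x | P x) F x <= \sum_(y | Q y) G y.
Proof.
move=> hinj hP G0; apply: le_trans (ler_sum _ (fun x Px => proj2 (hP x Px))) _.
rewrite -(big_imset _ hinj) /= big_mkcond [leRHS]big_mkcond /=.
apply: ler_sum => y _; case: ifP => [/imsetP[x Px ->]|_].
  by rewrite (proj1 (hP x Px)).
by case: ifP => // /G0.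
Qed.

Section Forests.
Variables (n : nat).
Local Notation I := 'I_n.
Implicit Types (A U J S : {set I}) (G : graph n) (pi : {ffun I -> I}) (a x y v : I).

Lemma adj_sym G x y : adj G x y = adj G y x.
Proof. by apply: eq_existsb => e; rewrite orbC. Qed.

Definition joins (e : edge n) x y := (val e == (x, y)) || (val e == (y, x)).

Lemma joins_inj e e' x y : joins e x y -> joins e' x y -> e = e'.
Proof.
move=> H H'; apply: val_inj; move: H H' (valP e) (valP e').
rewrite /joins => /orP[]/eqP-> /orP[]/eqP-> //= xy yx;
  by have := ltn_trans xy yx; rewrite ltnn.
Qed.

(* A parent function [pi] on the vertices it moves, all of them in [U] and with
   ancestor line ending in [A], is a forest rooted at [A]. *)
Definition leads A pi v := [exists a in A, fconnect pi v a].

Definition moved pi := [set v | pi v != v].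

Definition forest A U pi := [forall v, (v \in moved pi) ==> (v \in U) && leads A pi v].

Definition runs_in G pi := [forall v, (v \in moved pi) ==> adj G v (pi v)].

Lemma leadsP A pi v : reflect (exists2 a, a \in A & exists k, iter k pi v = a) (leads A pi v).
Proof.
apply: (iffP exists_inP) => -[a aA]; first by move/iter_findex; exists a => //; exists (findex pi v a).
by case=> k ka; exists a => //; rewrite -ka fconnect_iter.
Qed.

Definition reroot pi x a : {ffun I -> I} := [ffun v => if v == x then a else pi v].

Lemma fconnect_reroot pi x a : fconnect (reroot pi x a) x a.
Proof. by have := fconnect1 (reroot pi x a) x; rewrite ffunE eqxx. Qed.

(** An ancestor line changes only if it reaches [x]; there it used to stop, and now it goes on to
    [a]. *)
Lemma reroot_leads pi x a v b k : pi x = x -> iter k pi v = b ->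
  fconnect (reroot pi x a) v b \/ b = x /\ fconnect (reroot pi x a) v a.
Proof.
move=> pix; elim: k v => [|k IH] v; first by move=> /= ->; left.
have [->|vx] := eqVneq v x.
  move=> <-; right; split; first by elim: k.+1 => //= j ->.
  exact: fconnect_reroot.
rewrite iterSr => /IH.
have st : fconnect (reroot pi x a) v (pi v).
  by have := fconnect1 (reroot pi x a) v; rewrite ffunE (negbTE vx).
by case=> [|[-> ]] /(connect_trans st); [left | right].
Qed.

Lemma moved_reroot pi x a : pi x = x -> a != x -> moved (reroot pi x a) = x |: moved pi.
Proof.
move=> pix ax; apply/setP => v; rewrite !inE ffunE.
by case: (eqVneq v x) => [->|].
Qed.

Lemma forest_reroot A U pi x a : forest (x |: A) (U :\ x) pi -> x \in U -> a \in A ->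
  pi x = x /\ forest A U (reroot pi x a).
Proof.
move=> /forallP F xU aA.
have pix : pi x = x.
  by have := F x; rewrite !inE eqxx /= implybF negbK => /eqP.
split=> //; apply/forallP => v; apply/implyP; rewrite !inE ffunE.
have to_a b : b \in x |: A -> fconnect (reroot pi x a) v b \/ b = x /\ fconnect (reroot pi x a) v a ->
    leads A (reroot pi x a) v.
  move=> bA [vb|[_ va]]; last by apply/exists_inP; exists a.
  move: bA; rewrite in_setU1 => /orP[/eqP bx|bA]; last by apply/exists_inP; exists b.
  apply/exists_inP; exists a => //; apply: connect_trans vb _; rewrite bx.
  exact: fconnect_reroot.
have [-> _|vx piv] := eqVneq v x.
  rewrite xU /=; apply/exists_inP; exists a => //.
  exact: fconnect_reroot.
have := F v; rewrite !inE piv vx /= => /andP[-> /leadsP[b bA [k kb]]] /=.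
exact: to_a bA (reroot_leads a pix kb).
Qed.

Variables (R : realType) (eps : R).
Hypothesis eps_ge0 : 0 <= eps.

Definition forest_sum A U G : R :=
  \sum_(pi | forest A U pi && runs_in G pi) eps ^+ #|moved pi|.

Lemma forest_sum_ge1 A U G : 1 <= forest_sum A U G.
Proof.
have m0 : moved [ffun v => v] = set0 by apply/setP => v; rewrite !inE ffunE eqxx.
rewrite /forest_sum (bigD1 [ffun v => v]) /=; last first.
  by apply/andP; split; apply/forallP => v; rewrite m0 inE.
by rewrite m0 cards0 expr0 lerDl sumr_ge0 // => pi _; rewrite exprn_ge0.
Qed.

(** The forests of [G] are split by whether [pi x = a]. Rerooting [x] at [a] injects the forests
    rooted at [x |: A] into one class; the forests avoiding [e] lie in the other, as [e] is the only
    edge joining [a] and [x]. *)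
Lemma forest_sum_del A U G e a x : e \in G -> joins e a x -> a \in A -> x \in U ->
  x \notin A ->
  forest_sum A U (G :\ e) + eps * forest_sum (x |: A) (U :\ x) (G :\ e)
    <= forest_sum A U G.
Proof.
move=> eG eax aA xU xA.
have ax : a != x by apply: contraNneq xA => <-.
have adjG u v : adj (G :\ e) u v -> adj G u v.
  move=> /exists_inP[e']; rewrite !inE => /andP[_ e'G] e'uv.
  by apply/exists_inP; exists e'.
rewrite addrC [leRHS](bigID (fun pi : {ffun I -> I} => pi x == a)) /= lerD //.
  rewrite /forest_sum mulr_sumr; apply: (@ler_sum_inj _ _ _ _ _ _ _ (fun pi => reroot pi x a)).
  - move=> p p' /andP[fp _] /andP[fp' _] /ffunP E; apply/ffunP => v.
    have := E v; rewrite !ffunE; case: eqP => // -> _.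
    by rewrite (proj1 (forest_reroot fp xU aA)) (proj1 (forest_reroot fp' xU aA)).
  - move=> p /andP[fp rp]; have [px fr] := forest_reroot fp xU aA.
    rewrite fr /= moved_reroot // cardsU1 inE px eqxx exprS lexx; split=> //.
    rewrite ffunE eqxx eqxx andbT; apply/forallP => v; apply/implyP.
    rewrite moved_reroot // in_setU1 ffunE; case: eqP => [-> _|_ /= vm].
      by apply/exists_inP; exists e => //; move: eax; rewrite /joins orbC.
    by apply: adjG; move/forallP: rp => /(_ v); rewrite vm.
  - by move=> p _; rewrite exprn_ge0.
rewrite /forest_sum big_mkcond [leRHS]big_mkcond /=; apply: ler_sum => p _.
case: (forest A U p) => //=; case: (boolP (runs_in (G :\ e) p)) => [rp|_]; last first.
  by case: ifP => // _; rewrite exprn_ge0.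
rewrite ifT //; apply/andP; split.
  by apply/forallP => v; apply/implyP => vm; apply: adjG; move/forallP: rp => /(_ v); rewrite vm.
apply/negP => /eqP pxa; move/forallP: rp => /(_ x); rewrite inE pxa ax /=.
case/exists_inP => e'; rewrite !inE => /andP[e'e _] e'xa.
have e'e0 : e' = e by apply: (@joins_inj _ _ a x) => //; rewrite /joins orbC.
by rewrite e'e0 eqxx in e'e.
Qed.

End Forests.

(** * Influence bounds *)

(** The product of the two weight families, divided by [q], is a coupling of them. *)
Lemma weighted_sum_dist (R : realType) (S T : finType) (P : pred S) (Q : pred T)
    (p x : S -> R) (r y : T -> R) (q b : R) :
  0 < q -> (forall i, P i -> 0 <= p i) -> (forall j, Q j -> 0 <= r j) ->
  \sum_(i | P i) p i = q -> \sum_(j | Q j) r j = q ->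
  (forall i j, P i -> Q j -> `|x i - y j| <= b) ->
  `|\sum_(i | P i) p i * x i - \sum_(j | Q j) r j * y j| <= q * b.
Proof.
move=> q0 p0 r0 pq rq xy; rewrite -(ler_pM2l q0) -[X in X * `|_|]gtr0_norm // -normrM.
have -> : q * (\sum_(i | P i) p i * x i - \sum_(j | Q j) r j * y j) =
    \sum_(i | P i) \sum_(j | Q j) p i * r j * (x i - y j).
  rewrite mulrBr -{1}rq mulrC -[in X in _ - X]pq !mulr_suml -sumrB.
  apply: eq_bigr => i Pi; rewrite !mulr_sumr -sumrB.
  by apply: eq_bigr => j Qj; ring.
rewrite mulrA -{1}pq -{1}rq !mulr_suml; apply: le_trans (ler_norm_sum _ _ _) _.
apply: ler_sum => i Pi; rewrite mulr_sumr mulr_suml.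
apply: le_trans (ler_norm_sum _ _ _) _; apply: ler_sum => j Qj.
rewrite normrM ger0_norm ?mulr_ge0 ?p0 ?r0 //.
by rewrite ler_wpM2l ?mulr_ge0 ?p0 ?r0 ?xy.
Qed.

(** * Changing the boundary condition *)

Section Glue.
Variables (R : realType) (I X : finType) (w : {ffun I -> X} -> R).
Local Notation conf := {ffun I -> X}.
Hypothesis w_gt0 : forall s, 0 < w s.
Implicit Types (S : {set I}) (s t r : conf) (f : conf -> R).

Definition glue S s r : conf := [ffun i => if i \in S then s i else r i].

Lemma glue_id S s r : agree S s r -> glue S s r = r.
Proof. by move=> /agreeP sr; apply/ffunP => i; rewrite ffunE; case: ifP => // /sr. Qed.

Lemma agree_glue S s r : agree S s (glue S s r).
Proof. by apply/agreeP => i iS; rewrite ffunE iS. Qed.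

Lemma glue_glue S s t r : glue S s (glue S t r) = glue S s r.
Proof. by apply/ffunP => i; rewrite !ffunE; case: (i \in S). Qed.

Lemma sum_agree_glue S s t (F : conf -> R) :
  \sum_(r | agree S t r) F r = \sum_(r | agree S s r) F (glue S t r).
Proof.
rewrite (reindex_onto (glue S t) (glue S s)) /=; last first.
  by move=> r tr; rewrite glue_glue glue_id.
apply: eq_bigl => r; rewrite agree_glue glue_glue /=.
by apply/eqP/idP => [<-|]; [exact: agree_glue | exact: glue_id].
Qed.

(** The hypothesis makes [w (glue S t r) / w r] constant on the class of [s], so glueing carries the
    conditional law given [s] to the one given [t]. *)
Lemma cexp_glue S s t f :
  (forall r, agree S s r -> w r * w (glue S t s) = w s * w (glue S t r)) ->
  cexp w S f t = cexp w S (fun r => f (glue S t r)) s.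
Proof.
move=> H; rewrite /cexp /cmass !(sum_agree_glue S s t).
pose c := w (glue S t s) / w s.
have E r : agree S s r -> w (glue S t r) = c * w r.
  by move=> sr; rewrite /c mulrAC [w (glue _ _ s) * _]mulrC H // mulrC mulKf // gt_eqF.
have -> : \sum_(r | agree S s r) w (glue S t r) = c * \sum_(r | agree S s r) w r.
  by rewrite mulr_sumr; apply: eq_bigr => r /E.
have -> : \sum_(r | agree S s r) w (glue S t r) * f (glue S t r) =
    c * \sum_(r | agree S s r) w r * f (glue S t r).
  by rewrite mulr_sumr; apply: eq_bigr => r /E ->; rewrite mulrA.
by rewrite -mulf_div divff ?mul1r // /c mulf_neq0 ?invr_eq0 // gt_eqF.
Qed.

End Glue.

(** * Adding one bounded factor to the weight *)

Section Tilt.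
Variables (R : realType) (I X : finType) (w0 h : {ffun I -> X} -> R) (m M : R).
Local Notation conf := {ffun I -> X}.
Hypothesis w0_gt0 : forall s, 0 < w0 s.
Hypothesis m_gt0 : 0 < m.
Hypothesis mM : m < M.
Hypothesis h_bound : forall s, m <= h s <= M.
Implicit Types (S : {set I}) (s t r : conf) (f : conf -> R).
Let w s := w0 s * h s.
Let k := m / M.

(* With [h = m + (h - m)], the measure tilted by [h] is a mixture whose part of
   weight [m / M] is the untilted measure. *)
Lemma tilt_split S S' s f : S \subset S' -> meas S' h ->
  exists c : conf -> R, [/\ forall r, 0 <= c r,
    \sum_(r | agree S s r) c r = 1 - k &
    cexp w S f s = k * cexp w0 S f s + \sum_(r | agree S s r) c r * cexp w0 S' f r].
Proof.
move=> SS' mh; have M0 : 0 < M by apply: lt_trans mM.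
have h0 r : 0 < h r by case/andP: (h_bound r) => /(lt_le_trans m_gt0).
have w_gt0 r : 0 < w r by rewrite mulr_gt0.
set Z0 := cmass w0 S s; set Z := cmass w S s.
have Z00 : 0 < Z0 by exact: cmass_gt0.
have Zp : 0 < Z by exact: cmass_gt0.
(* The untilted part has weight [m * Z0 / Z], at least [k]. The excess over [k] is moved to the
   remainder, so that the weights of the mixture do not depend on [s]. *)
pose c r := (m * Z0 / Z - k) / Z0 + (h r - m) / Z.
have mc : meas S' c by move=> r r' /mh rr'; rewrite /c rr'.
have kle : k <= m * Z0 / Z.
  rewrite /k -!mulrA ler_pM2l // ler_pdivlMr // mulrC ler_pdivrMr // /Z /Z0 /cmass mulr_suml.
  by apply: ler_sum => r _; rewrite ler_pM2l //; case/andP: (h_bound r).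
have E g : \sum_(r | agree S s r) w0 r * c r * g r = cexp w S g s - k * cexp w0 S g s.
  have -> : \sum_(r | agree S s r) w0 r * c r * g r =
      ((m * Z0 / Z - k) / Z0 - m / Z) * (\sum_(r | agree S s r) w0 r * g r)
      + (\sum_(r | agree S s r) w r * g r) / Z.
    rewrite mulr_sumr mulr_suml -big_split; apply: eq_bigr => r _.
    by rewrite /c /w /=; ring.
  rewrite /cexp -/Z -/Z0 addrC; congr (_ + _).
  by field; rewrite !gt_eqF.
exists (fun r => w0 r * c r); split.
- move=> r; case/andP: (h_bound r) => mhr _; rewrite mulr_ge0 ?(ltW (w0_gt0 _)) //.
  by apply: addr_ge0; rewrite divr_ge0 ?(ltW Z00) ?(ltW Zp) ?subr_ge0.
- have := E (fun=> 1); rewrite (eq_bigr (fun r => w0 r * c r)); last by move=> r _; rewrite mulr1.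
  by move=> ->; rewrite !(cexp_meas _ (f := fun=> 1)) ?mulr1.
- by rewrite (sum_cexp w0_gt0 f s SS' mc) E; ring.
Qed.

(** Both mixtures give weight [k] to the untilted part, which is compared by [d]; the remainders
    have equal mass [1 - k] and are coupled as a product. *)
Lemma tilt_dist S S' s t f b d : S \subset S' -> meas S' h ->
  `|cexp w0 S f s - cexp w0 S f t| <= d ->
  (forall r r', agree S s r -> agree S t r' ->
     `|cexp w0 S' f r - cexp w0 S' f r'| <= b) ->
  `|cexp w S f s - cexp w S f t| <= k * d + (1 - k) * b.
Proof.
move=> SS' mh D H; have M0 : 0 < M by apply: lt_trans mM.
have [c [c0 c1 ->]] := tilt_split s f SS' mh.
have [c' [c0' c1' ->]] := tilt_split t f SS' mh.
rewrite opprD addrACA -mulrBr; apply: le_trans (ler_normD _ _) _; apply: lerD.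
  by rewrite normrM gtr0_norm ?divr_gt0 // ler_pM2l ?divr_gt0.
apply: weighted_sum_dist => //.
by rewrite subr_gt0 /k ltr_pdivrMr // mul1r.
Qed.

End Tilt.

(** * Disagreement percolation *)

Section Model.
Variables (R : realType) (n : nat) (X : finType).
Variables (phi : 'I_n -> X -> R) (psi : X -> X -> R) (m M : R).
Hypothesis phi_gt0 : forall i x, 0 < phi i x.
Hypothesis m_gt0 : 0 < m.
Hypothesis mM : m < M.
Hypothesis psi_bound : forall x y, m <= psi x y <= M.
Local Notation conf := {ffun 'I_n -> X}.
Implicit Types (G : graph n) (s t r : conf) (f : conf -> R) (A L S : {set 'I_n}).

Definition wt G s : R :=
  (\prod_i phi i (s i)) * \prod_(e in G) psi (s (val e).1) (s (val e).2).

Let psi_gt0 x y : 0 < psi x y.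
Proof. by case/andP: (psi_bound x y) => /(lt_le_trans m_gt0). Qed.

Lemma wt_gt0 G s : 0 < wt G s.
Proof. by rewrite mulr_gt0 ?prodr_gt0. Qed.

Lemma wt_del G e : e \in G ->
  wt G = fun s => wt (G :\ e) s * psi (s (val e).1) (s (val e).2).
Proof.
move=> eG; apply/funext => s; rewrite /wt (big_setD1 e) //= -mulrA; congr (_ * _).
exact: mulrC.
Qed.

(* Each factor of the weight either does not see [S] or sees only [S] and the
   vertices where [s] and [t] agree. *)
Lemma wt_glue G S s t r1 r2 : agree S s r1 -> agree S s r2 ->
  {in G, forall e, ((val e).1 \in S) && ((val e).2 \in S) \/
    forall i, i \in [:: (val e).1; (val e).2] -> i \in S -> s i = t i} ->
  wt G r1 * wt G (glue S t r2) = wt G r2 * wt G (glue S t r1).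
Proof.
move=> /agreeP s1 /agreeP s2 HG; rewrite /wt mulrACA [RHS]mulrACA.
rewrite -!big_split /=; congr (_ * _).
  apply: eq_bigr => i _; rewrite !ffunE; case: ifP => iS; last by rewrite mulrC.
  by rewrite -s1 // -s2.
apply: eq_bigr => e eG; case: (HG e eG) => [/andP[e1 e2]|H].
  by rewrite !ffunE e1 e2 -!s1 // -!s2.
have E r i : {in S, s =1 r} -> i \in [:: (val e).1; (val e).2] -> glue S t r i = r i.
  by move=> sr ie; rewrite ffunE; case: ifP => // iS; rewrite -(H i) // sr.
by rewrite !E ?inE ?eqxx ?orbT // mulrC.
Qed.

Variable eps : R.
Hypothesis eps_ge : (1 - m / M) * expR 1 <= eps.

Let k := m / M.

Let k_bound : 0 <= k <= 1.
Proof.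
have M0 : 0 < M by apply: lt_trans mM.
by rewrite /k divr_ge0 ?(ltW m_gt0) ?(ltW M0) //= ler_pdivrMr // mul1r ltW.
Qed.

Let eps_ge0 : 0 <= eps.
Proof.
by apply: le_trans eps_ge; rewrite mulr_ge0 ?expR_ge0 // subr_ge0; case/andP: k_bound.
Qed.

(* Exploring the edges between the disagreement set [A] and the free vertices
   one at a time, the expected number of disagreements is dominated by the size
   [c] of a percolation cluster, and [c <= a + exp (c - a)]. *)
Lemma influence_forest G A L f (l a : R) s t : 0 <= l -> lip L l f -> agree L s t ->
  [disjoint A & L] ->
  `|cexp (wt G) (A :|: L) f s - cexp (wt G) (A :|: L) f t|
    <= l * (a + expR (#|A|%:R - a) * forest_sum eps A (~: (A :|: L)) G).
Proof.
move=> l0 lf.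
(* When no edge leads from [A'] to a free vertex, the free vertices have the same conditional law
   under both boundary conditions, so the glued configurations differ only on [A']. *)
have base G' A' s' t' : agree L s' t' -> [disjoint A' & L] ->
    ~ (exists2 e, e \in G' & exists b x, [/\ b \in A', x \notin A' :|: L & joins e b x]) ->
    `|cexp (wt G') (A' :|: L) f s' - cexp (wt G') (A' :|: L) f t'|
      <= l * (a + expR (#|A'|%:R - a) * forest_sum eps A' (~: (A' :|: L)) G').
  move=> st' AL' noedge; set S := A' :|: L.
  rewrite (@cexp_glue _ _ _ _ (wt_gt0 G') S s' t'); last first.
    move=> r sr; apply: (@wt_glue G' S s' t' r s') => // [|e eG]; first exact: agree_refl.
    have [/andP[e1 e2]|eS] := boolP (((val e).1 \in S) && ((val e).2 \in S)); [by left|right].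
    move=> i ie iS; apply: (elimT (agreeP _ _ _) st').
    move: (iS); rewrite inE => /orP[iA|//]; case: noedge; exists e => //; exists i.
    move: ie; rewrite !inE => /orP[]/eqP E; subst i; move: eS; rewrite iS ?andbT /= => oS.
      by exists (val e).2; split=> //; rewrite /joins -surjective_pairing eqxx.
    by exists (val e).1; split=> //; rewrite /joins -surjective_pairing eqxx orbT.
  rewrite -cexpB; apply: (cexp_norm_le (wt_gt0 G')) => r sr.
  have D : #|diffs r (glue S t' r)|%:R <= #|A'|%:R :> R.
    rewrite ler_nat subset_leq_card //; apply/subsetP => i; rewrite inE ffunE.
    case: ifP; rewrite ?eqxx // inE => /orP[//|iL].
    move/agreeP: sr => <-; last by rewrite inE iL orbT.
    by move/agreeP: st' => -> //; rewrite eqxx.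
  have lipr : `|f r - f (glue S t' r)| <= l * #|diffs r (glue S t' r)|%:R.
    apply: lf; apply: agree_trans (agree_sub (subsetUr A' L) (agree_glue _ _ _)).
    by apply: agree_trans st'; rewrite agree_sym; apply: agree_sub sr; apply: subsetUr.
  apply: le_trans lipr _; rewrite ler_wpM2l //; apply: le_trans D _.
  (* [expR y >= 1 + y] at [y = #|A'| - a] gives [#|A'| <= a + expR y]. *)
  have := expR_ge1Dx (#|A'|%:R - a); have := forest_sum_ge1 eps_ge0 A' (~: S) G'.
  have := expR_gt0 (#|A'|%:R - a); nra.
(* Induction on the number of edges, since every explored edge is deleted. *)
move: {2}#|G| (leqnn #|G|) => N.
elim: N G A s t => [|N IH] G A s t GN st AL; set S := A :|: L;
  have [[e eG]|noedge] := pselect (exists2 e, e \in G &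
    exists a x, [/\ a \in A, x \notin S & joins e a x]).
- by move: GN eG; rewrite leqn0 cards_eq0 => /eqP ->; rewrite inE.
- exact: base.
- case=> b [x [bA xS ebx]]; have xU : x \in ~: S by rewrite inE.
  have xA : x \notin A by apply: contra xS; rewrite inE => ->.
  have xL : x \notin L by apply: contra xS; rewrite inE orbC => ->.
  have Ge : (#|G :\ e| <= N)%N by move: GN; rewrite (cardsD1 e) eG.
  have UE : ~: (x |: A :|: L) = ~: S :\ x.
    by apply/setP => i; rewrite !inE; case: (i == x).
  rewrite (wt_del eG).
  pose h r : R := psi (r (val e).1) (r (val e).2).
  have mh : meas (x |: S) h.
    move=> r r' /agreeP rr'; rewrite /h.
    by case/orP: ebx => /eqP -> /=; rewrite !rr' // !inE ?eqxx ?bA ?orbT.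
  (* With weight [k] the edge is ignored and the disagreement set stays [A]; with weight [1 - k] the
     spin at [x] is revealed and counted as a disagreement at worst. *)
  pose b' := l * (a + expR (#|x |: A|%:R - a) * forest_sum eps (x |: A) (~: (x |: A :|: L)) (G :\ e)).
  apply: le_trans (@tilt_dist _ _ _ (wt (G :\ e)) h m M (wt_gt0 _) m_gt0 mM
    (fun r => psi_bound _ _) S (x |: S) s t f b' _ (subsetU1 _ _) mh (IH _ _ _ _ Ge st AL) _) _.
    move=> r r' sr tr'; rewrite /S setUA; apply: (IH _ (x |: A)) => //.
      apply: agree_trans (agree_trans _ st) _; last by apply: agree_sub tr'; apply: subsetUr.
      by rewrite agree_sym; apply: agree_sub sr; apply: subsetUr.
    by rewrite disjoints_subset subUset sub1set inE xL -disjoints_subset.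
  rewrite /b' UE -/k -/S.
  have := forest_sum_del eps_ge0 eG ebx bA xU xA.
  have := forest_sum_ge1 eps_ge0 A (~: S) (G :\ e).
  have := forest_sum_ge1 eps_ge0 (x |: A) (~: S :\ x) (G :\ e).
  set Z := forest_sum _ _ _ G; set Z1 := forest_sum _ _ _ _; set Z2 := forest_sum _ _ _ _.
  (* The new disagreement costs a factor [expR 1], which [eps] absorbs; what remains is the
     recursion [forest_sum_del]. *)
  move=> Z11 Z21 ZZ; rewrite cardsU1 xA natrD -addrA [expR (1%:R + _)]expRD.
  rewrite mulrCA [(1 - k) * _]mulrCA -mulrDr.
  rewrite ler_wpM2l //; set E := expR (_ - a).
  have E0 : 0 < E by apply: expR_gt0.
  apply: le_trans (_ : a + E * (k * Z2 + (1 - k) * expR 1 * Z1) <= _).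
    by rewrite le_eqVlt; apply/orP; left; apply/eqP; ring.
  rewrite lerD2l ler_pM2l //; apply: le_trans ZZ; apply: lerD.
    by rewrite ler_piMl ?(le_trans _ Z21) //; case/andP: k_bound.
  by rewrite ler_wpM2r // (le_trans _ Z11).
- exact: base.
Qed.

End Model.

(** * Poincare inequality on small components *)

Section Components.
Variables (n : nat).
Implicit Types (S T : {set 'I_n}) (G : graph n).

(** [T] is the connected component of [v0] in the graph induced on [S]. A forest rooted at [v] with
    the most moved vertices spans it, since an edge leaving the forest would allow one more vertex
    to be attached. *)
Lemma component_spanned G S v0 : v0 \in S -> exists T,
  [/\ v0 \in T, T \subset S,
      forall x y, x \in T -> y \in S :\: T -> ~~ adj G x y
    & forall v, v \in T -> exists pi,
        forest [set v] (S :\ v) pi && runs_in G pi /\ v |: moved pi = T].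
Proof.
move=> v0S; pose e : rel 'I_n := fun x y => [&& adj G x y, x \in S & y \in S].
have sym_e : connect_sym e.
  by apply: sym_connect_sym => x y; rewrite /e adj_sym [(x \in S) && _]andbC.
pose T := [set x | connect e v0 x].
have TS : T \subset S.
  apply/subsetP => x; rewrite inE => /connectP[p ep ->].
  elim: p v0 v0S ep {T} => //= y p IH x0 _ /andP[/and3P[_ _ yS]]; exact: IH.
exists T; split=> //; first by rewrite inE connect0.
  move=> x y; rewrite !inE => vx /andP[vy yS]; apply: contra vy => xy.
  apply: connect_trans (vx) (connect1 _); rewrite /e xy yS andbT /=.
  by apply: (subsetP TS); rewrite inE.
move=> v vT; have vS := subsetP TS _ vT.
pose ok (pi : {ffun 'I_n -> 'I_n}) := forest [set v] (S :\ v) pi && runs_in G pi.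
have mid : moved [ffun x : 'I_n => x] = set0.
  by apply/setP => x; rewrite !inE ffunE eqxx.
have ok0 : ok [ffun x => x].
  by apply/andP; split; apply/forallP => x; rewrite mid inE.
case: (@arg_maxnP _ _ ok (fun pi => #|moved pi|) ok0) => pi /andP[fpi rpi] max.
exists pi; split; first by rewrite fpi.
have fS x : x \in moved pi -> (x \in S) /\ fconnect pi x v.
  move/forallP: fpi => /(_ x) /implyP F /F; rewrite !inE => /andP[/andP[_ ->]].
  by case/exists_inP => b; rewrite inE => /eqP ->.
have adjpi x : x \in moved pi -> adj G x (pi x).
  by move/forallP: rpi => /(_ x) /implyP.
have vfix : v \notin moved pi.
  by apply/negP; move/forallP: fpi => /(_ v) /implyP F /F; rewrite !inE eqxx.
have closedJ : fingraph.closed e (mem (v |: moved pi)).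
  apply: (intro_closed sym_e) => x y /and3P[xy xS yS] xJ.
  apply: contraT => yJ; move: (yJ); rewrite in_setU1 negb_or => /andP[yv ym].
  have piy : pi y = y by apply/eqP; move: ym; rewrite inE negbK.
  have yx : x != y by apply: contraNneq yJ => <-.
  pose pi' := reroot pi y x.
  have mE : moved pi' = y |: moved pi by apply: moved_reroot.
  have lift z : z \notin [set y] -> fconnect pi z v -> fconnect pi' z v.
    move=> _ /iter_findex /(reroot_leads x piy) [//|[vy _]].
    by rewrite vy eqxx in yv.
  have xv : fconnect pi' x v.
    move: xJ; rewrite in_setU1 => /orP[/eqP->//|xm].
    by apply: lift; [rewrite inE | case: (fS x xm)].
  have okpi' : ok pi'.
    apply/andP; split; apply/forallP => z; apply/implyP; rewrite mE in_setU1.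
      case: (eqVneq z y) => [-> _|zy /= zm].
        rewrite !inE yv yS /=; apply/exists_inP; exists v; first by rewrite inE.
        exact: connect_trans (fconnect_reroot _ _ _) xv.
      have [zS zv] := fS z zm; rewrite !inE zS andbT.
      apply/andP; split; first by apply: contraNneq vfix => <-.
      by apply/exists_inP; exists v; rewrite ?inE ?lift ?inE.
    rewrite ffunE; case: (eqVneq z y) => [-> _|zy /= /adjpi //].
    by rewrite adj_sym.
  by have := max _ okpi'; rewrite mE cardsU1 ym add1n /= ltnn.
apply/eqP; rewrite eqEsubset; apply/andP; split; apply/subsetP => x.
  rewrite in_setU1 => /orP[/eqP->//|xm].
  have [xS xv] := fS x xm; rewrite inE sym_e.
  have cv : connect e x v.
    apply: (connect_sub _ xv) => y z; rewrite /= => /eqP <-.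
    have [->|my] := eqVneq (pi y) y; first exact: connect0.
    have ym : y \in moved pi by rewrite inE.
    have [yS yv] := fS y ym.
    apply: connect1; rewrite /e adjpi // yS /=.
    have [pm|] := boolP (pi y \in moved pi); first by case: (fS _ pm).
    rewrite inE negbK => /eqP pf.
    have := iter_findex yv; case: (findex _ _ _) => [/= yE|k].
      by move: vfix; rewrite -yE ym.
    by rewrite iterSr (_ : iter k pi (pi y) = pi y) => [->//|]; elim: k => //= k ->.
  by apply: connect_trans cv _; rewrite sym_e; move: vT; rewrite inE.
rewrite inE => v0x; have := closed_connect closedJ (x := v) (y := x).
rewrite !inE eqxx /= => <- //.
by apply: connect_trans v0x; rewrite sym_e; move: vT; rewrite inE.
Qed.

End Components.

Definition edges_in n (G : graph n) (T : {set 'I_n}) : {set edge n} :=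
  [set e in G | ((val e).1 \in T) && ((val e).2 \in T)].

(** The expectation under [w0] is a competitor in the minimization [dv_min] for [w]. *)
Lemma dv_compare (R : realType) (I X : finType) (w w0 : {ffun I -> X} -> R) (c : R) L f :
  (forall s, 0 < w s) -> (forall s, 0 < w0 s) -> (forall s, w s <= c * w0 s) ->
  dv w L f <= c * dv w0 L f.
Proof.
move=> wp w0p ww0; apply: le_trans (dv_min wp f (@meas_cexp _ _ _ w0 L f)) _.
rewrite /dv /dot mulr_sumr; apply: ler_sum => s _.
by rewrite -!mulrA -expr2 [leRHS]mulrA ler_wpM2r ?sqr_ge0.
Qed.

(** * Comparison with independent spins on a component *)

Section BlockPoincare.
Variables (R : realType) (n : nat) (X : finType).
Variables (phi : 'I_n -> X -> R) (psi : X -> X -> R) (m M kap : R).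
Hypothesis phi_gt0 : forall i x, 0 < phi i x.
Hypothesis m_gt0 : 0 < m.
Hypothesis mM : m < M.
Hypothesis psi_bound : forall x y, m <= psi x y <= M.
Hypothesis kap_ge : M / m <= kap.
Hypothesis kap_ge1 : 1 <= kap.
Local Notation conf := {ffun 'I_n -> X}.
Local Notation wt := (wt phi psi).
Implicit Types (G : graph n) (s t r : conf) (f g : conf -> R) (S T : {set 'I_n}).

Let wp G s : 0 < wt G s.
Proof. exact: wt_gt0 psi_bound _ _. Qed.

(** No factor of the weight sees both [T] and [T'], so the law on [T'] is insensitive to the spins
    on [T]. The expectation is thus a function of the coordinates outside both sets, and the tower
    property identifies it. *)
Lemma cexp_indep G T T' g : [disjoint T & T'] ->
  (forall x y, x \in T -> y \in T' -> ~~ adj G x y) ->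
  meas (~: T) g -> cexp (wt G) (~: T') g =1 cexp (wt G) (~: (T :|: T')) g.
Proof.
move=> TT' noadj mg s; set S := ~: (T :|: T').
have ST' : S \subset ~: T' by rewrite setCS subsetUr.
have mE : meas S (cexp (wt G) (~: T') g).
  move=> s1 t1 /agreeP st1; rewrite [RHS](@cexp_glue _ _ _ _ (wp G) _ s1).
    congr (_ / _); apply: eq_bigr => r /agreeP sr; congr (_ * _); apply: mg.
    apply/agreeP => i iT; rewrite ffunE; case: ifP => // iT'.
    rewrite -(sr i iT'); apply: st1; by move: iT iT'; rewrite !inE negb_or => -> ->.
  move=> r sr; apply: (@wt_glue _ _ _ _ _ G (~: T') s1 t1 r s1) => // [|e eG].
    exact: agree_refl.
  have [/andP[e1 e2]|eT'] := boolP (((val e).1 \in ~: T') && ((val e).2 \in ~: T')); [by left|right].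
  have adje : adj G (val e).1 (val e).2.
    by apply/exists_inP; exists e; rewrite // -surjective_pairing eqxx.
  have nT i : i \in [:: (val e).1; (val e).2] -> i \notin T.
    move: eT'; rewrite negb_and !inE !negbK => eT' /orP[]/eqP ->; apply/negP => eT.
      case/orP: eT' => eT'; first by move/disjoint_setI0/setP/(_ (val e).1): TT'; rewrite !inE eT eT'.
      by have := noadj _ _ eT eT'; rewrite adje.
    case/orP: eT' => eT'; last by move/disjoint_setI0/setP/(_ (val e).2): TT'; rewrite !inE eT eT'.
    by have := noadj _ _ eT eT'; rewrite adj_sym adje.
  by move=> i /nT iT; rewrite inE => iT'; rewrite st1 // !inE negb_or iT.
by rewrite -(cexp_tower (wp G) g ST') [RHS](cexp_meas (wp G) mE).
Qed.

Lemma dv_indep G T T' f : [disjoint T & T'] ->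
  (forall x y, x \in T -> y \in T' -> ~~ adj G x y) ->
  dv (wt G) (~: (T :|: T')) f <= dv (wt G) (~: T) f + dv (wt G) (~: T') f.
Proof.
move=> TT' noadj; apply: dv_tensor => // g; first exact: cexp_indep.
rewrite setUC; apply: cexp_indep; first by rewrite disjoint_sym.
by move=> x y xT yT; rewrite adj_sym noadj.
Qed.

Lemma dv_setT G f : dv (wt G) setT f = 0.
Proof.
rewrite /dv /dot big1 // => s _; rewrite cexp_meas ?subrr ?mulr0 // => s1 t1 /agreeP st.
by congr f; apply/ffunP => i; apply: st; rewrite inE.
Qed.

(** Efron-Stein: without edges inside [T] its vertices are conditionally independent and can be
    split off one at a time. *)
Lemma dv_product G T f : edges_in G T = set0 ->
  dv (wt G) (~: T) f <= \sum_(v in T) dv (wt G) [set~ v] f.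
Proof.
move: {2}#|T| (erefl #|T|) => N; elim: N T => [|N IH] T TN eT.
  by move/eqP: TN; rewrite cards_eq0 => /eqP ->; rewrite setC0 dv_setT big_set0.
have /card_gt0P[v vT] : (0 < #|T|)%N by rewrite TN.
have TE : T = [set v] :|: (T :\ v) by rewrite setD1K.
rewrite (big_setD1 v) //= {1}TE; apply: le_trans (dv_indep _ _ _) _.
- by rewrite disjoints_subset sub1set !inE eqxx.
- move=> x y; rewrite !inE => /eqP -> /andP[_ yT]; apply/negP => /exists_inP[e eG vy].
  have : e \in edges_in G T by rewrite inE eG; case/orP: vy => /eqP -> /=; rewrite vT yT.
  by rewrite eT inE.
rewrite lerD2l; apply: IH; first by move: TN; rewrite (cardsD1 v) vT => -[].
apply/eqP; rewrite -subset0 -eT; apply/subsetP => e; rewrite !inE.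
by case/and3P=> -> /andP[_ ->] /andP[_ ->].
Qed.

(* Holley--Stroock comparison with the model whose edges inside [T] are deleted,
   under which the vertices of [T] are independent. *)
Lemma dv_block G T f :
  dv (wt G) (~: T) f <= kap ^+ #|edges_in G T| * \sum_(v in T) dv (wt G) [set~ v] f.
Proof.
set k := #|_|; pose G0 := G :\: edges_in G T.
have M0 : 0 <= M by apply: le_trans (ltW mM); apply: ltW.
have wE s : wt G s = wt G0 s * \prod_(e in edges_in G T) psi (s (val e).1) (s (val e).2).
  rewrite /wt (big_setID (edges_in G T)) /= mulrCA mulrC; congr (_ * _).
  by apply: eq_bigl => e; rewrite !inE andb_idl // => /andP[].
have up s : wt G s <= M ^+ k * wt G0 s.
  rewrite wE mulrC ler_pM2r //.
  rewrite /k -prodr_const; apply: ler_prod => e _.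
  case/andP: (psi_bound (s (val e).1) (s (val e).2)) => mp ->.
  by rewrite (le_trans _ mp) // ltW.
have dn s : wt G0 s <= (m ^+ k)^-1 * wt G s.
  rewrite ler_pdivlMl ?exprn_gt0 // wE mulrC ler_pM2l //.
  rewrite /k -prodr_const; apply: ler_prod => e _; rewrite ltW //=.
  by case/andP: (psi_bound (s (val e).1) (s (val e).2)).
apply: le_trans (dv_compare _ f (wp G) (wp G0) up) _.
have e0 : edges_in G0 T = set0 by apply/setP => e; rewrite !inE; do 3!case: (_ \in _).
apply: le_trans (ler_wpM2l (exprn_ge0 k M0) (dv_product f e0)) _.
rewrite mulr_sumr [leRHS]mulr_sumr; apply: ler_sum => v _.
apply: le_trans (ler_wpM2l (exprn_ge0 k M0) (dv_compare _ f (wp G0) (wp G) dn)) _.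
rewrite mulrA ler_wpM2r ?dv_ge0 // -expr_div_n lerXn2r ?nnegrE //.
  by rewrite divr_ge0 // ltW.
exact: le_trans kap_ge1.
Qed.

(** Summing over all trees at [v] inside [S] dominates the constant of the component of [v], one of
    whose spanning trees is a term, and is monotone in [S]. *)
Definition block_const G S v : R :=
  \sum_(pi | forest [set v] (S :\ v) pi && runs_in G pi)
    kap ^+ #|edges_in G (v |: moved pi)|.

Let kap_ge0 : 0 <= kap. Proof. exact: le_trans kap_ge1. Qed.

Lemma block_const_sub G S S' v : S \subset S' -> block_const G S v <= block_const G S' v.
Proof.
move=> SS'; rewrite /block_const big_mkcond [leRHS]big_mkcond /=.
apply: ler_sum => pi _; case: (boolP (forest [set v] (S :\ v) pi)) => /= [F|_]; last first.
  by case: ifP => // _; rewrite exprn_ge0.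
rewrite (_ : forest _ _ _) //; apply/forallP => x; apply/implyP => xm.
move/forallP: F => /(_ x); rewrite xm /= => /andP[xS ->]; rewrite andbT.
exact: subsetP (setSD _ SS') _ xS.
Qed.

(** Components of [S] are split off one at a time by [dv_indep], each being treated by
    [dv_block]. *)
Lemma poincare_free G S f :
  dv (wt G) (~: S) f <= \sum_(v in S) block_const G S v * dv (wt G) [set~ v] f.
Proof.
move: {2}#|S| (leqnn #|S|) => N; elim: N S => [|N IH] S SN.
  by move: SN; rewrite leqn0 cards_eq0 => /eqP ->; rewrite setC0 dv_setT big_set0.
have [->|/set0Pn[v0 v0S]] := eqVneq S set0; first by rewrite setC0 dv_setT big_set0.
have [T [v0T TS noadj span]] := component_spanned G v0S.
have SE : S = T :|: (S :\: T) by rewrite setDE setUIr setUCr setIT (setUidPr TS).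
have dT : [disjoint T & S :\: T] by rewrite disjoints_subset setDE setCI setCK subsetUr.
rewrite {1}SE; apply: le_trans (dv_indep _ dT noadj) _.
rewrite [leRHS](big_setID T) /= (setIidPr TS) lerD //.
  apply: le_trans (dv_block _ _ _) _; rewrite mulr_sumr; apply: ler_sum => v vT.
  rewrite ler_wpM2r ?dv_ge0 //.
  have [pi [pok piT]] := span v vT.
  rewrite /block_const (bigD1 pi) //= piT lerDl sumr_ge0 // => pi' _.
  by rewrite exprn_ge0.
apply: le_trans (IH _ _) _.
  rewrite -ltnS; apply: leq_trans SN; apply: proper_card.
  apply/properP; split; first exact: subsetDl.
  by exists v0; rewrite // !inE v0T.
apply: ler_sum => v _; rewrite ler_wpM2r ?dv_ge0 // block_const_sub //.
exact: subsetDl.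
Qed.

End BlockPoincare.

(** * Revealing random vertices *)

Lemma sum_const_ord (R : realType) n (c : R) : \sum_(i < n) c = n%:R * c.
Proof. by rewrite sumr_const card_ord mulr_natl. Qed.

Section Reveal.
Variables (R : realType) (n : nat).
Local Notation I := 'I_n.
Hypothesis n_gt0 : (0 < n)%N.
Implicit Types (L J : {set I}) (F H : {set I} -> R).

(** Expectation of [F] at the set obtained by adding to [L] [k] independent uniform vertices, drawn
    with replacement. *)
Fixpoint reveal k F L : R :=
  if k is k'.+1 then n%:R^-1 * \sum_u reveal k' F (u |: L) else F L.

Let nR_gt0 : 0 < n%:R :> R. Proof. by rewrite ltr0n. Qed.

Lemma ler_reveal k F H L : (forall L', F L' <= H L') -> reveal k F L <= reveal k H L.
Proof.
move=> FH; elim: k L => //= k IH L.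
by rewrite ler_pM2l ?invr_gt0 // ler_sum.
Qed.

Lemma reveal_sum k (T : finType) (P : pred T) (F : T -> {set I} -> R) L :
  reveal k (fun L' => \sum_(i | P i) F i L') L = \sum_(i | P i) reveal k (F i) L.
Proof.
elim: k L => //= k IH L; under eq_bigr do rewrite IH.
by rewrite exchange_big mulr_sumr.
Qed.

Lemma revealZ k c F L : reveal k (fun L' => c * F L') L = c * reveal k F L.
Proof.
elim: k L => //= k IH L; under eq_bigr do rewrite IH.
by rewrite -mulr_sumr mulrCA.
Qed.

Let card_leq J : (#|J| <= n)%N.
Proof. by have := max_card (mem J); rewrite card_ord. Qed.

Lemma reveal_disjoint k J L :
  reveal k (fun L' => [disjoint J & L']%:R) L =
    (1 - #|J|%:R / n%:R) ^+ k * [disjoint J & L]%:R.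
Proof.
elim: k L => [|k IH] L /=; first by rewrite mul1r.
under eq_bigr do rewrite IH.
rewrite -mulr_sumr exprSr -mulrA mulrCA; congr (_ * _).
have E u : [disjoint J & u |: L] = (u \notin J) && [disjoint J & L].
  by rewrite disjoint_sym disjoints_subset subUset sub1set inE -disjoints_subset disjoint_sym.
have [JL|JL] := boolP [disjoint J & L]; last first.
  by rewrite big1 ?mulr0 // => u _; rewrite E (negbTE JL) andbF.
under eq_bigr do rewrite E JL andbT.
have -> : \sum_u (u \notin J)%:R = n%:R - #|J|%:R :> R.
  rewrite -natr_sum -(natrB _ (card_leq J)); congr _%:R.
  transitivity #|~: J|; last by rewrite cardsCs setCK card_ord.
  by rewrite -sum1_card [RHS]big_mkcond; apply: eq_bigr => u _; rewrite inE; case: (_ \in _).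
by rewrite mulr1; field; rewrite gt_eqF.
Qed.

(** Each of the [b * n] draws misses [J] with probability [1 - #|J| / n], and
    [1 - x <= expR (- x)]. *)
Lemma reveal_disjoint_le b J L :
  reveal (b * n) (fun L' => [disjoint J & L']%:R) L <= expR (- b%:R) ^+ #|J|.
Proof.
rewrite reveal_disjoint; set x := _ / _.
have x1 : 0 <= 1 - x.
  by rewrite subr_ge0 ler_pdivrMr // mul1r ler_nat card_leq.
apply: le_trans (_ : (1 - x) ^+ (b * n) <= _).
  by rewrite ler_piMr ?exprn_ge0 // lern1 leq_b1.
apply: le_trans (_ : expR (- x) ^+ (b * n) <= _).
  by rewrite lerXn2r ?nnegrE ?expR_ge0 // (le_trans _ (expR_ge1Dx _)).
rewrite -!expRM_natl ler_expR natrM.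
have -> : b%:R * n%:R * - x = - (b%:R * (n%:R * x)) by ring.
by rewrite /x (mulrC #|J|%:R) mulVKf ?gt_eqF // mulrN mulrC.
Qed.

Lemma reveal_decay k F L c : 0 <= c ->
  (forall L', c * F L' <= n%:R^-1 * \sum_u F (u |: L')) -> c ^+ k * F L <= reveal k F L.
Proof.
move=> c0 H; elim: k L => [|k IH] L /=; first by rewrite mul1r.
rewrite exprSr -mulrA; apply: le_trans (ler_wpM2l (exprn_ge0 k c0) (H L)) _.
rewrite mulrCA ler_pM2l ?invr_gt0 // mulr_sumr.
by apply: ler_sum.
Qed.

End Reveal.

(** * Poincare inequality for the whole graph *)

Section GlobalPoincare.
Variables (R : realType) (n : nat) (X : finType).
Variables (phi : 'I_n -> X -> R) (psi : X -> X -> R) (m M kap eps : R) (b : nat).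
Hypothesis phi_gt0 : forall i x, 0 < phi i x.
Hypothesis m_gt0 : 0 < m.
Hypothesis mM : m < M.
Hypothesis psi_bound : forall x y, m <= psi x y <= M.
Hypothesis kap_ge : M / m <= kap.
Hypothesis kap_ge1 : 1 <= kap.
Hypothesis eps_ge : (1 - m / M) * expR 1 <= eps.
Hypothesis b_ge : expR (- b%:R) <= eps.
Local Notation conf := {ffun 'I_n -> X}.
Local Notation wt := (wt phi psi).
Implicit Types (G : graph n) (s t r : conf) (f g : conf -> R) (L : {set 'I_n}).

(** Trees are given by their parent functions towards [v]. The exponent of [kap'] counts all edges
    of [G] spanned by the tree, not only the tree edges. *)
Definition tree_sum (eps' kap' : R) G v : R :=
  \sum_(pi | forest [set v] [set~ v] pi && runs_in G pi)
    eps' ^+ #|moved pi| * kap' ^+ #|edges_in G (v |: moved pi)|.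

Let eps_ge0 : 0 <= eps. Proof. exact: le_trans (expR_ge0 _) b_ge. Qed.
Let kap_ge0 : 0 <= kap. Proof. exact: le_trans kap_ge1. Qed.

Lemma forestS (A U U' : {set 'I_n}) pi : U \subset U' -> forest A U pi -> forest A U' pi.
Proof.
move=> UU' /forallP F; apply/forallP => v; apply/implyP => vm.
by have := F v; rewrite vm /= => /andP[/(subsetP UU') -> ->].
Qed.

Lemma forest_sum_le_tree_sum G L v : v \notin L ->
  forest_sum eps [set v] (~: (v |: L)) G <= tree_sum eps kap G v.
Proof.
move=> vL; rewrite /forest_sum /tree_sum big_mkcond [leRHS]big_mkcond /=.
apply: ler_sum => pi _; case: ifP => [/andP[F ->]|_].
  rewrite (forestS _ F) ?setCS ?subsetUl //=.
  by rewrite ler_peMr ?exprn_ge0 // exprn_ege1.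
by case: ifP => // _; rewrite mulr_ge0 ?exprn_ge0.
Qed.

(** The choice [a = ln W] in [influence_forest] reduces the exponential term to at most
    [expR (1 - ln W) * W = expR 1]. *)
Lemma influence_tree_sum G L f (W l : R) u s t :
  0 < W -> (forall v, tree_sum eps kap G v <= W) ->
  0 <= l -> lip L l f -> agree L s t -> u \notin L ->
  `|cexp (wt G) (u |: L) f s - cexp (wt G) (u |: L) f t| <= (ln W + expR 1) * l.
Proof.
move=> W0 GW l0 lf st uL.
have dL : [disjoint [set u] & L] by rewrite disjoints_subset sub1set inE.
have := influence_forest phi_gt0 m_gt0 mM psi_bound eps_ge G (ln W) l0 lf st dL.
move/le_trans; apply; rewrite mulrC ler_wpM2r // lerD2l cards1 expRD expRN lnK ?posrE //.
rewrite -mulrA ger_pMr ?expR_gt0 // ler_pdivrMl // mulr1.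
exact: le_trans (forest_sum_le_tree_sum _ uL) (GW u).
Qed.

(** The mean variance left after [b * n] reveals is bounded below by [contraction_dv], iterated, and
    above by [poincare_free] on the hidden set, averaged. *)
Lemma global_poincare G f (W : R) : (0 < n)%N -> 1 <= W ->
  (forall v, tree_sum eps kap G v <= W) -> ln W + expR 1 <= n%:R ->
  (1 - (ln W + expR 1) / n%:R) ^+ (b * n) * dv (wt G) set0 f <=
    W * \sum_v dv (wt G) [set~ v] f.
Proof.
move=> n0 W1 GW etan; set eta := ln W + expR 1.
have wp := wt_gt0 phi_gt0 m_gt0 psi_bound G.
have W0 : 0 < W by apply: lt_le_trans W1.
have eta0 : 0 < eta by rewrite ltr_wpDl ?expR_gt0 // ln_ge0.
have nR : 0 < n%:R :> R by rewrite ltr0n.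
have step L : (1 - eta / n%:R) * dv (wt G) L f <= n%:R^-1 * \sum_u dv (wt G) (u |: L) f.
  have := @contraction_dv _ _ _ _ wp L eta eta0
    (fun f l u s t => @influence_tree_sum G L f W l u s t W0 GW) f.
  rewrite sumrB sum_const_ord => H.
  rewrite ler_pdivlMl //.
  have -> : n%:R * ((1 - eta / n%:R) * dv (wt G) L f) = (n%:R - eta) * dv (wt G) L f.
    by field; rewrite gt_eqF.
  move: H; lra.
apply: le_trans (reveal_decay n0 (b * n) set0 _ step) _.
  by rewrite subr_ge0 ler_pdivrMr // mul1r.
(* A tree lies in the hidden set only if its moved vertices avoid [L]. Written with this indicator,
   the bound depends on [L] in a way that [reveal_disjoint_le] can average. *)
have bound L : dv (wt G) L f <= \sum_v dv (wt G) [set~ v] f *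
    \sum_(pi | forest [set v] [set~ v] pi && runs_in G pi)
      kap ^+ #|edges_in G (v |: moved pi)| * [disjoint moved pi & L]%:R.
  rewrite -{1}(setCK L).
  apply: le_trans (poincare_free phi_gt0 m_gt0 mM psi_bound kap_ge kap_ge1 G (~: L) f) _.
  rewrite big_mkcond; apply: ler_sum => v _; case: ifP => [_|_]; last first.
    rewrite mulr_ge0 ?dv_ge0 ?sumr_ge0 // => pi _.
    by rewrite mulr_ge0 ?exprn_ge0.
  rewrite mulrC ler_wpM2l ?dv_ge0 // /block_const big_mkcond [leRHS]big_mkcond /=.
  apply: ler_sum => pi _; case: ifP => [/andP[F ->]|_]; last first.
    by case: ifP => // _; rewrite mulr_ge0 ?exprn_ge0.
  rewrite (forestS _ F) /=; last by apply/subsetP => i; rewrite !inE => /andP[].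
  rewrite (_ : [disjoint _ & _]) ?mulr1 //.
  rewrite disjoints_subset; apply/subsetP => i im; move/forallP: F => /(_ i).
  by rewrite im /= => /andP[]; rewrite !inE => /andP[].
apply: le_trans (ler_reveal n0 _ _ bound) _.
rewrite reveal_sum mulr_sumr; apply: ler_sum => v _.
rewrite revealZ reveal_sum mulrC ler_wpM2r ?dv_ge0 //.
apply: le_trans (GW v); apply: ler_sum => pi _.
rewrite revealZ mulrC ler_wpM2r ?exprn_ge0 //.
(* A tree is hidden with probability at most [expR (- b)] per moved vertex, hence at most [eps]. *)
apply: le_trans (reveal_disjoint_le _ n0 _ _ _) _.
by rewrite lerXn2r ?nnegrE ?expR_ge0.
Qed.

End GlobalPoincare.

(** * Mixing from a Poincare inequality *)

Section Dynamics.
Variables (R : realType) (M : soft_model R) (n : nat) (G : graph n).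
Local Notation conf := (config M n).
Implicit Types (s t : conf) (f g : conf -> R) (v : 'I_n).

Definition model_weight : conf -> R :=
  wt (fun _ x => expR (activity x)) (fun x y : state M => expR (interaction x y)) G.
Local Notation w := model_weight.

Lemma model_weightE s : w s = expR (hamiltonian G s).
Proof. by rewrite /w /wt /hamiltonian expRD !expR_sum. Qed.

Lemma model_weight_gt0 s : 0 < w s.
Proof. by rewrite model_weightE expR_gt0. Qed.

(** An edge at [v] has [v] as exactly one of its two ordered endpoints, so the two indicators never
    both count. *)
Lemma sum_adj v (F : 'I_n -> R) : \sum_(u | adj G v u) F u =
  \sum_(e in G) (((val e).1 == v)%:R * F (val e).2 + ((val e).2 == v)%:R * F (val e).1).
Proof.
have E u : (adj G v u)%:R * F u = \sum_(e in G) (joins e v u)%:R * F u.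
  case: (boolP (adj G v u)) => [/exists_inP[e eG evu]|/exists_inPn noe].
    rewrite (bigD1 e) //= big1 ?addr0 => [|e' /andP[_ e'e]].
      by rewrite /joins evu.
    case: (boolP (joins e' v u)) => [e'vu|]; last by rewrite mul0r.
    by rewrite (joins_inj e'vu evu) eqxx in e'e.
  by rewrite mul0r big1 // => e /noe /negbTE eN; rewrite /joins eN mul0r.
rewrite big_mkcond (eq_bigr (fun u => (adj G v u)%:R * F u)); last first.
  by move=> u _; case: ifP; rewrite ?mul1r ?mul0r.
under eq_bigr do rewrite E.
rewrite exchange_big; apply: eq_bigr => e _ /=.
have D (b : 'I_n) c : (c == v)%:R * F b = \sum_u ((c, b) == (v, u))%:R * F u.
  rewrite (bigD1 b) //= big1 ?addr0 => [|u ub]; last first.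
    by rewrite xpair_eqE [b == u]eq_sym (negbTE ub) andbF mul0r.
  by rewrite xpair_eqE eqxx andbT.
rewrite !D -big_split; apply: eq_bigr => u _ /=; rewrite -mulrDl; congr (_ * _).
rewrite /joins -natrD; congr _%:R.
case: e => -[i j] /= ij; rewrite !xpair_eqE.
case: (boolP ((i == v) && (j == u))) => [/andP[/eqP iv /eqP ju]|_].
  have -> : (i == u) = false; last by rewrite !andbF.
  by apply/eqP => iu; move: ij; rewrite ju iu ltnn.
by rewrite add0n andbC.
Qed.

(** The terms of the Hamiltonian that do not see [v] form the constant [C]; hence the update rule is
    the conditional Gibbs law at [v]. *)
Lemma local_weight_update s v : exists2 c : R, 0 < c &
  forall x, w (update s v x) = c * local_weight G s v x.
Proof.
pose C : R := \sum_(u | u != v) activity (s u) + \sum_(e in G)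
  (((val e).1 != v) && ((val e).2 != v))%:R * interaction (s (val e).1) (s (val e).2).
exists (expR C); first exact: expR_gt0.
move=> x; rewrite model_weightE /local_weight -expRD; congr expR.
rewrite /hamiltonian (bigD1 v) //= ffunE eqxx sum_adj /C.
have -> : \sum_(u | u != v) activity (update s v x u) = \sum_(u | u != v) activity (s u).
  by apply: eq_bigr => u /negbTE uv; rewrite ffunE uv.
rewrite [X in _ + _ + X = _](_ : _ = \sum_(e in G)
    (((val e).1 != v) && ((val e).2 != v))%:R * interaction (s (val e).1) (s (val e).2) +
  \sum_(e in G) (((val e).1 == v)%:R * interaction (s (val e).2) x +
    ((val e).2 == v)%:R * interaction (s (val e).1) x)); first by ring.
rewrite -big_split; apply: eq_bigr => -[[i j] /= ij] _; rewrite !ffunE.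
case: (eqVneq i v) ij => [->|iv] ij; case: (eqVneq j v) ij => [->|jv] ij /=.
- by rewrite ltnn in ij.
- by rewrite mul0r mul1r mul0r addr0 add0r interaction_sym.
- by rewrite !mul0r mul1r !add0r.
- by rewrite !mul0r mul1r !addr0.
Qed.

Lemma sum_agree_update s v (F : conf -> R) :
  \sum_(t | agree [set~ v] s t) F t = \sum_x F (update s v x).
Proof.
rewrite (reindex_onto (fun x => update s v x) (fun t : conf => t v)) /=; last first.
  move=> t /agreeP st; apply/ffunP => u; rewrite ffunE.
  by case: eqP => [->//|/eqP uv]; rewrite st // !inE.
apply: eq_bigl => x; rewrite ffunE eqxx eqxx andbT.
by apply/agreeP => u; rewrite !inE ffunE => /negbTE ->.
Qed.

Lemma gibbs_step_cexp s f :
  \sum_t gibbs_step G s t * f t = n%:R^-1 * \sum_v cexp w [set~ v] f s.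
Proof.
under eq_bigr do rewrite /gibbs_step mulr_suml.
rewrite exchange_big mulr_sumr; apply: eq_bigr => v _ /=.
under eq_bigr do rewrite -mulrA.
rewrite -mulr_sumr; congr (_ * _).
set W := \sum_y local_weight G s v y.
transitivity (\sum_t \sum_(x | update s v x == t) local_weight G s v x / W * f t).
  by apply: eq_bigr => t _; rewrite mulr_suml.
rewrite (exchange_big_dep predT) //= /W /cexp /cmass !sum_agree_update.
have [c c0 cE] := local_weight_update s v.
under [X in _ = X / _]eq_bigr do rewrite cE -mulrA.
under [X in _ = _ / X]eq_bigr do rewrite cE.
rewrite -!mulr_sumr -mulf_div divff ?gt_eqF // mul1r mulr_suml.
apply: eq_bigr => x _; rewrite (big_pred1 (update s v x)); last first.
  by move=> t; rewrite /= eq_sym.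
by rewrite mulrAC.
Qed.

Definition evolve k f s := \sum_t gibbs_law G k s t * f t.

Definition gibbs_op f s := \sum_t gibbs_step G s t * f t.

Lemma evolveS k f : evolve k.+1 f =1 evolve k (gibbs_op f).
Proof.
move=> s; rewrite /evolve /gibbs_op /=.
under eq_bigr do rewrite mulr_suml.
rewrite exchange_big; apply: eq_bigr => r _ /=; rewrite mulr_sumr.
by apply: eq_bigr => t _; rewrite mulrA.
Qed.

Lemma evolve0 f : evolve 0 f =1 f.
Proof.
move=> s; rewrite /evolve (bigD1 s) //= eqxx mul1r big1 ?addr0 // => t.
by rewrite eq_sym => /negbTE ->; rewrite mul0r.
Qed.

Hypothesis n_gt0 : (0 < n)%N.
Let nR_gt0 : 0 < n%:R :> R. Proof. by rewrite ltr0n. Qed.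
Let wp := model_weight_gt0.

Lemma gibbs_op_stationary f : cexp w set0 (gibbs_op f) =1 cexp w set0 f.
Proof.
move=> s; rewrite -[LHS]mul1r.
have : \sum_(t | agree set0 s t) w t * gibbs_op f t = \sum_(t | agree set0 s t) w t * f t.
  under eq_bigr do rewrite /gibbs_op gibbs_step_cexp mulrCA mulr_sumr.
  rewrite -mulr_sumr exchange_big /=.
  under eq_bigr do rewrite (sum_cexp1 wp) ?sub0set //.
  by rewrite sum_const_ord mulKf // gt_eqF.
by rewrite mul1r /cexp => ->.
Qed.

(** The step is an average of [n] projections. By convexity the squared norm of the image of [f0] is
    at most the average of the projected squared norms, and the Poincare inequality bounds what they
    lose. *)
Lemma dv_gibbs_op f (K : R) : 0 < K ->
  dv w set0 f <= K * \sum_v dv w [set~ v] f ->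
  dv w set0 (gibbs_op f) <= (1 - (n%:R * K)^-1) * dv w set0 f.
Proof.
move=> K0 PK; pose f0 s := f s - cexp w set0 f s.
have f0E v s : cexp w [set~ v] f0 s = cexp w [set~ v] f s - cexp w set0 f s.
  rewrite cexpB [X in _ - X](cexp_meas wp) //.
  exact: meas_sub (sub0set _) (@meas_cexp _ _ _ w set0 f).
have dvv v : dv w [set~ v] f = dot w f0 f0 - dot w (cexp w [set~ v] f0) (cexp w [set~ v] f0).
  rewrite -(dvE wp); apply: eq_dot => s; rewrite f0E /f0; ring.
apply: le_trans (dv_min wp _ (@meas_cexp _ _ _ w set0 f)) _.
apply: le_trans (_ : n%:R^-1 * \sum_v dot w (cexp w [set~ v] f0) (cexp w [set~ v] f0) <= _).
  rewrite /dot exchange_big mulr_sumr; apply: ler_sum => s _ /=.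
  pose a v := cexp w [set~ v] f0 s.
  have -> : gibbs_op f s - cexp w set0 f s = n%:R^-1 * \sum_v a v.
    rewrite /a; under eq_bigr do rewrite f0E.
    rewrite sumrB sum_const_ord mulrBr mulKf ?gt_eqF //.
    by rewrite /gibbs_op gibbs_step_cexp.
  have -> : \sum_v w s * cexp w [set~ v] f0 s * cexp w [set~ v] f0 s = w s * \sum_v a v ^+ 2.
    by rewrite mulr_sumr; apply: eq_bigr => v _; rewrite -mulrA expr2.
  rewrite -mulrA -expr2 exprMn [leRHS]mulrCA ler_pM2l //.
  rewrite expr2 -mulrA ler_pM2l ?invr_gt0 // ler_pdivrMl //.
  (* Cauchy-Schwarz for the constant vector, read off from a sum of squares. *)
  have : 0 <= \sum_v (n%:R * a v - \sum_u a u) ^+ 2.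
    by apply: sumr_ge0 => v _; apply: sqr_ge0.
  have -> : \sum_v (n%:R * a v - \sum_u a u) ^+ 2 =
      n%:R * (n%:R * (\sum_v a v ^+ 2) - (\sum_u a u) ^+ 2).
    set S := \sum_u a u.
    transitivity (\sum_v (n%:R ^+ 2 * a v ^+ 2 - 2 * n%:R * S * a v + S ^+ 2)).
      by apply: eq_bigr => v _; ring.
    by rewrite big_split sumrB /= sum_const_ord -!mulr_sumr -/S; ring.
  by rewrite pmulr_rge0 // subr_ge0.
have -> : \sum_v dot w (cexp w [set~ v] f0) (cexp w [set~ v] f0) =
    n%:R * dv w set0 f - \sum_v dv w [set~ v] f.
  rewrite (eq_bigr _ (fun v _ => dvv v)) sumrB sum_const_ord -[dv w set0 f]/(dot w f0 f0).
  by ring.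
rewrite mulrBr mulKf ?gt_eqF // mulrBl mul1r lerD2l lerN2 invfM -mulrA ler_pM2l ?invr_gt0 //.
by rewrite ler_pdivrMl.
Qed.

Variable K : R.
Hypothesis K_gt0 : 0 < K.
Hypothesis poincare : forall f, dv w set0 f <= K * \sum_v dv w [set~ v] f.

Lemma dv_evolve k f : dv w set0 (evolve k f) <= expR (- k%:R / (n%:R * K)) * dv w set0 f
  /\ cexp w set0 (evolve k f) =1 cexp w set0 f.
Proof.
have nK0 : 0 < n%:R * K by rewrite mulr_gt0.
elim: k f => [|k IH] f.
  rewrite oppr0 mul0r expR0 mul1r; split; last by apply: eq_cexp; apply: evolve0.
  rewrite le_eqVlt; apply/orP; left; apply/eqP.
  by apply: eq_dot => s; rewrite evolve0 (eq_cexp _ _ (evolve0 f)).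
have [IH1 IH2] := IH (gibbs_op f); split; last first.
  by move=> s; rewrite (eq_cexp _ _ (evolveS k f)) IH2 gibbs_op_stationary.
have -> : dv w set0 (evolve k.+1 f) = dv w set0 (evolve k (gibbs_op f)).
  by apply: eq_dot => s; rewrite evolveS (eq_cexp _ _ (evolveS k f)).
apply: le_trans IH1 _.
have -> : - k.+1%:R / (n%:R * K) = - k%:R / (n%:R * K) + - (n%:R * K)^-1.
  by rewrite -natr1; ring.
rewrite expRD -mulrA ler_pM2l ?expR_gt0 //.
apply: le_trans (dv_gibbs_op K_gt0 (poincare f)) _.
by rewrite ler_wpM2r ?dv_ge0 // (le_trans _ (expR_ge1Dx _)).
Qed.

(** Testing against the sign of the difference turns total variation into the deviation at [s] of
    [evolve k f] from its mean. Its square is at most the variance over [w s], and [D] bounds the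
    inverse stationary probability of [s]. *)
Lemma tv_evolve k s (D : R) : cmass w set0 s <= D * w s ->
  tv_dist (gibbs_law G k s) (gibbs_measure G) <= 2^-1 * Num.sqrt (expR (- k%:R / (n%:R * K)) * D).
Proof.
move=> ZD; rewrite /tv_dist ler_pM2l ?invr_gt0 //.
pose f t : R := Num.sg (gibbs_law G k s t - gibbs_measure G t).
have f1 t : f t * f t <= 1.
  by rewrite /f -expr2 sqr_sg lern1 leq_b1.
have ZE : cmass w set0 s = partition_function M G.
  rewrite /cmass /partition_function; under eq_bigr do rewrite model_weightE.
  by apply: eq_bigl => t; rewrite agree0.
have -> : \sum_t `|gibbs_law G k s t - gibbs_measure G t| = evolve k f s - cexp w set0 f s.
  have -> : cexp w set0 f s = \sum_t gibbs_measure G t * f t.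
    rewrite /cexp ZE mulr_suml (eq_bigl predT) => [|t]; last exact: agree0.
    by apply: eq_bigr => t _; rewrite model_weightE mulrAC.
  by rewrite /evolve -sumrB; apply: eq_bigr => t _; rewrite -mulrBl normrEsg mulrC.
have [dvk meank] := dv_evolve k f.
apply: le_trans (ler_norm _) _; rewrite -sqrtr_sqr ler_sqrt; last first.
  rewrite mulr_ge0 ?expR_ge0 // -(pmulr_lge0 _ (wp s)).
  by apply: le_trans ZD; apply: ltW; apply: cmass_gt0.
rewrite -(ler_pM2l (wp s)); apply: le_trans (_ : dv w set0 (evolve k f) <= _).
  rewrite /dv /dot (bigD1 s) //= -mulrA -expr2 meank lerDl sumr_ge0 // => t _.
  by rewrite -mulrA mulr_ge0 ?(ltW (wp _)) // -expr2 sqr_ge0.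
apply: le_trans dvk _; rewrite mulrCA ler_pM2l ?expR_gt0 // mulrC.
apply: le_trans ZD; rewrite (dvE wp) lerBlDr; apply: le_trans (_ : cmass w set0 s <= _); last first.
  by rewrite lerDl dot_ge0.
rewrite /cmass (eq_bigl predT); last by move=> t; rewrite agree0.
by apply: ler_sum => t _; rewrite -mulrA ler_piMr // ltW.
Qed.

(** The square root in [tv_evolve] halves the exponent, so reaching [expR (- 1)] takes
    [k / (n * K) >= D + 2]. *)
Lemma mixing_time_le (D T : R) : (forall s, cmass w set0 s <= expR D * w s) ->
  n%:R * K * (D + 2) <= T -> 0 <= T -> (mixing_time M G <= (T + 1)%:E)%E.
Proof.
move=> ZD TD T0; set k := (Num.truncn T).+1.
have nK0 : 0 < n%:R * K by rewrite mulr_gt0.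
apply: le_trans (_ : (k%:R : R)%:E <= _)%E; last first.
  by rewrite lee_fin /k -natr1 lerD2r truncn_le.
apply: ereal_inf_lbound; exists k => //= s.
apply: le_trans (tv_evolve k (ZD s)) _.
rewrite [(2 * expR 1)^-1]invfM ler_pM2l ?invr_gt0 // -expRD -expRN.
have -> : expR (- 1) = Num.sqrt (expR (- 2)) :> R.
  have -> : - 2 = - 1 + - 1 :> R by ring.
  by rewrite expRD -expr2 sqrtr_sqr ger0_norm ?expR_ge0.
rewrite ler_sqrt ?expR_ge0 // ler_expR mulNr.
have : D + 2 <= k%:R / (n%:R * K); last by lra.
rewrite ler_pdivlMr // mulrC; apply: le_trans TD _.
by rewrite ltW // truncnS_gt.
Qed.

End Dynamics.

(** * Tree sums in the random graph *)

Section RandomGraph.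
Variables (R : realType) (n : nat) (p : R).
Hypothesis p_ge0 : 0 <= p.
Hypothesis p_le1 : p <= 1.
Implicit Types (G : graph n) (pi : {ffun 'I_n -> 'I_n}) (v : 'I_n).

Lemma Gnp_mass_ge0 G : 0 <= Gnp_mass p G.
Proof. by apply: prodr_ge0 => e _; case: ifP; rewrite ?subr_ge0. Qed.

Lemma Gnp_expect_prod (f : edge n -> bool -> R) :
  \sum_(G : graph n) Gnp_mass p G * \prod_e f e (e \in G) =
  \prod_e (p * f e true + (1 - p) * f e false).
Proof.
rewrite bigA_distr; apply: eq_bigr => G _; rewrite /Gnp_mass -big_split.
by apply: eq_bigr => e _ /=; case: ifP.
Qed.

Lemma Gnp_mass_sum : \sum_(G : graph n) Gnp_mass p G = 1.
Proof.
have := Gnp_expect_prod (fun _ _ => 1); rewrite [in RHS]big1 => [<-|e _]; last by ring.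
by apply: eq_bigr => G _; rewrite big1 ?mulr1.
Qed.

Lemma Gnp_prob_compl (A : pred (graph n)) :
  Gnp_prob p A = 1 - Gnp_prob p (predC A).
Proof. by rewrite -Gnp_mass_sum /Gnp_prob [X in X - _](bigID A) /= addrK. Qed.

Lemma Gnp_prob_ge0 (A : pred (graph n)) : 0 <= Gnp_prob p A.
Proof. by apply: sumr_ge0 => G _; apply: Gnp_mass_ge0. Qed.

Lemma Gnp_prob_le1 (A : pred (graph n)) : Gnp_prob p A <= 1.
Proof. by rewrite Gnp_prob_compl lerBlDr lerDl Gnp_prob_ge0. Qed.

Lemma Gnp_prob_mono (A B : pred (graph n)) : (forall G, A G -> B G) ->
  Gnp_prob p A <= Gnp_prob p B.
Proof.
move=> AB; rewrite /Gnp_prob big_mkcond [leRHS]big_mkcond; apply: ler_sum => G _.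
by case: ifP => [/AB ->//|_]; case: ifP => // _; apply: Gnp_mass_ge0.
Qed.

(** Markov's inequality and a union bound over [I]. *)
Lemma Gnp_prob_all_le (I : finType) (Y : I -> graph n -> R) (c W : R) : 0 < W ->
  (forall i G, 0 <= Y i G) -> (forall i, \sum_(G : graph n) Gnp_mass p G * Y i G <= c) ->
  1 - #|I|%:R * c / W <= Gnp_prob p (fun G => [forall i, Y i G <= W]).
Proof.
move=> W0 Y0 EY; rewrite Gnp_prob_compl lerD2l lerN2 ler_pdivlMr //.
rewrite mulr_natl -sumr_const; apply: le_trans (ler_sum _ (fun i _ => EY i)).
rewrite exchange_big /= /Gnp_prob mulr_suml big_mkcond; apply: ler_sum => G _ /=.
rewrite -mulr_sumr; case: ifP => [|_]; last first.
  by rewrite mulr_ge0 ?Gnp_mass_ge0 ?sumr_ge0.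
rewrite negb_forall => /existsP[i]; rewrite -ltNge => /ltW WY.
rewrite ler_wpM2l ?Gnp_mass_ge0 //; apply: le_trans WY _.
by rewrite (bigD1 i) //= lerDl sumr_ge0.
Qed.

Lemma joins_ex (x y : 'I_n) : x != y -> exists e, joins e x y.
Proof.
rewrite -val_eqE neq_ltn => /orP[xy|yx].
  by exists (exist _ (x, y) xy); rewrite /joins eqxx.
by exists (exist _ (y, x) yx); rewrite /joins eqxx orbT.
Qed.

Definition forest_edges pi : {set edge n} := [set e | [exists x in moved pi, joins e x (pi x)]].

Lemma forest_fixed v U pi : forest [set v] (U :\ v) pi -> v \notin moved pi.
Proof. by move=> /forallP F; apply/negP => /(implyP (F v)); rewrite !inE eqxx. Qed.

Lemma forest_reach v U pi x : forest [set v] U pi -> x \in moved pi -> exists k, iter k pi x = v.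
Proof.
move=> /forallP /(_ x) F /(implyP F) /andP[_ /leadsP[a]]; by rewrite inE => /eqP ->.
Qed.

(** Sending a moved vertex to the edge to its parent is injective: two vertices sharing an edge
    would be parents of each other, and their ancestor lines would never reach [v]. *)
Lemma card_forest_edges v U pi : forest [set v] (U :\ v) pi ->
  #|forest_edges pi| = #|moved pi|.
Proof.
move=> F; pose h x := [pick e | joins e x (pi x)].
have hP x : x \in moved pi -> exists2 e, h x = Some e & joins e x (pi x).
  rewrite inE /h => px; case: pickP => [e ej|no]; first by exists e.
  have [e] : exists e, joins e x (pi x) by apply: joins_ex; rewrite eq_sym.
  by rewrite no.
rewrite -(@card_imset _ _ (@Some (edge n))); last by move=> e e' [].
rewrite -(@card_in_imset _ _ h).
  congr #|pred_of_set _|; apply/setP => o; apply/imsetP/imsetP.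
    case=> e; rewrite inE => /exists_inP[x xm ex] ->; exists x => //.
    by have [e' -> e'x] := hP x xm; rewrite (joins_inj ex e'x).
  by case=> x xm ->; have [e -> ex] := hP x xm; exists e => //; rewrite inE; apply/exists_inP; exists x.
move=> x y xm ym; have [e hx ex] := hP x xm; have [e' hy ey] := hP y ym.
rewrite hx hy => -[ee]; rewrite -{}ee in ey; apply/eqP; apply: contraT => xy.
have [xpy pxy] : x = pi y /\ pi x = y.
  move: ex ey; rewrite /joins => /orP[]/eqP-> /orP[]/eqP[] E1 E2; split=> //;
    by move/eqP: xy.
have [k] := forest_reach F xm.
have cyc j : iter j pi x = x \/ iter j pi x = y.
  by elim: j => [|j [IH|IH]]; [left| right; rewrite /= IH | left; rewrite /= IH].
have vm := forest_fixed F.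
by case: (cyc k) => -> E; rewrite -E ?xm ?ym in vm.
Qed.

Lemma card_inside (T : {set 'I_n}) :
  (#|[set e : edge n | ((val e).1 \in T) && ((val e).2 \in T)]| <= #|T| * n)%N.
Proof.
rewrite -[X in (_ <= _ * X)%N]card_ord -cardsT -cardsX -(card_imset _ val_inj).
by apply: subset_leq_card; apply/subsetP => z /imsetP[e]; rewrite !inE => /andP[e1 _] ->; rewrite e1.
Qed.

(** Edges are independent: each tree edge must be present, and any other pair inside the tree
    contributes [1 + p * (kap - 1)]. There are at most [n] pairs per vertex of the tree, root
    included. *)
Lemma forest_expect v U pi (kap : R) : 1 <= kap -> forest [set v] (U :\ v) pi ->
  \sum_(G : graph n) Gnp_mass p G *
    ((runs_in G pi)%:R * kap ^+ #|edges_in G (v |: moved pi)|) <=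
  (p * kap) ^+ #|moved pi| * expR (p * (kap - 1) * n%:R) ^+ #|moved pi|.+1.
Proof.
move=> kap1 F; set T := v |: moved pi.
have kap0 : 0 <= kap by apply: le_trans kap1.
pose ins (e : edge n) := ((val e).1 \in T) && ((val e).2 \in T).
pose f e (b : bool) : R := (if e \in forest_edges pi then b%:R else 1) * (if b && ins e then kap else 1).
apply: le_trans (_ : \sum_(G : graph n) Gnp_mass p G * \prod_e f e (e \in G) <= _).
  apply: ler_sum => G _; rewrite ler_wpM2l ?Gnp_mass_ge0 //.
  rewrite big_split /= ler_pM ?ler0n ?exprn_ge0 //.
    case: (boolP (runs_in G pi)) => [/forallP rG|_]; last by apply: prodr_ge0 => e _; case: ifP.
    rewrite big1 // => e _; rewrite inE; case: ifP => // /exists_inP[x xm ex].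
    have /exists_inP[e' e'G e'x] : adj G x (pi x) by apply: (implyP (rG x)).
    by rewrite (joins_inj ex e'x) e'G.
  rewrite -big_mkcond /= prodr_const le_eqVlt; apply/orP; left; apply/eqP.
  by congr (_ ^+ _); apply: eq_card => e; rewrite [RHS]unfold_in inE.
rewrite Gnp_expect_prod.
(* A tree edge is also granted the factor of a spanned pair, so that the two kinds can be counted
   separately. *)
apply: le_trans (_ : \prod_e ((if e \in forest_edges pi then p * kap else 1) *
    (if ins e then 1 + p * (kap - 1) else 1)) <= _).
  have pk := mulr_ge0 p_ge0 kap0; have q0 : 0 <= p * (kap - 1) by rewrite mulr_ge0 ?subr_ge0.
  have pkq := mulr_ge0 pk q0; have p10 : 0 <= 1 - p by rewrite subr_ge0.
  apply: ler_prod => e _; rewrite /f; case: (e \in _); case: (ins e) => /=;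
    rewrite ?mulr1 ?mul1r ?mul0r ?mulr0 ?addr0; apply/andP; split; move: pk q0 pkq p10; nra.
rewrite big_split /= -!big_mkcond /= !prodr_const (card_forest_edges F).
rewrite ler_wpM2l ?exprn_ge0 ?mulr_ge0 //.
have q1 : 1 <= 1 + p * (kap - 1) by rewrite lerDl mulr_ge0 ?subr_ge0.
apply: le_trans (_ : (1 + p * (kap - 1)) ^+ (#|T| * n) <= _).
  rewrite ler_weXn2l //; apply: leq_trans (card_inside T).
  by apply: subset_leq_card; apply/subsetP => e; rewrite inE.
rewrite /T cardsU1 (forest_fixed F) add1n mulnC [X in expR X]mulrC expRM_natl -exprM.
by rewrite lerXn2r ?nnegrE ?expR_ge0 ?(le_trans _ q1) ?expR_ge1Dx.
Qed.

(** A forest with moved set [J] maps [J] into [v |: J], so at most [#|J|.+1 ^ #|J|] parent functions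
    have this moved set. *)
Lemma sum_forests_le v U (y : R) : 0 <= y ->
  \sum_(pi | forest [set v] (U :\ v) pi) y ^+ #|moved pi| <=
  \sum_(J : {set 'I_n}) (y * #|J|.+1%:R) ^+ #|J|.
Proof.
move=> y0; pose F (J : {set 'I_n}) (x z : 'I_n) : R :=
  if x \in J then y * (z \in v |: J)%:R else (z == x)%:R.
have F0 J x z : 0 <= F J x z by rewrite /F; case: ifP; rewrite ?mulr_ge0.
apply: le_trans (_ : \sum_(pi : {ffun 'I_n -> 'I_n}) \sum_(J : {set 'I_n})
    \prod_x F J x (pi x) <= _).
  rewrite big_mkcond; apply: ler_sum => pi _; case: ifP => [fpi|_]; last first.
    by apply: sumr_ge0 => J _; apply: prodr_ge0.
  rewrite (bigD1 (moved pi)) //= -[leLHS]addr0 lerD ?sumr_ge0 //; last first.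
    by move=> J _; apply: prodr_ge0.
  rewrite -prodr_const big_mkcond le_eqVlt; apply/orP; left; apply/eqP.
  apply: eq_bigr => x _; rewrite /F; case: ifP => [xm|]; last first.
    by rewrite inE => /negbFE ->.
  suff -> : pi x \in v |: moved pi by rewrite mulr1.
  rewrite in_setU1; apply/orP; have [pm|] := boolP (pi x \in moved pi); first by right.
  rewrite inE negbK => /eqP pf; left.
  have [[|k]] := forest_reach fpi xm.
    by move=> /= xv; have := forest_fixed fpi; rewrite -xv xm.
  by rewrite iterSr => <-; apply/eqP; elim: k => //= k <-.
rewrite exchange_big; apply: ler_sum => J _ /=.
rewrite -(bigA_distr_bigA (F J)) -prodr_const [leRHS]big_mkcond; apply: ler_prod => x _.
rewrite sumr_ge0 //= /F; case: ifP => xJ.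
  rewrite -mulr_sumr ler_wpM2l // -natr_sum ler_nat.
  apply: leq_trans (_ : #|v |: J| <= _)%N; last by rewrite cardsU1; case: (_ \notin _).
  by rewrite -sum1_card [leqRHS]big_mkcond; apply: leq_sum => z _; case: (_ \in _).
rewrite (bigD1 x) //= eqxx big1 ?addr0 // => z /negbTE -> //.
Qed.

End RandomGraph.

(** * Series bounds and the expected tree sum *)

Lemma natSX_le_fact (R : realType) j : (j.+1%:R : R) ^+ j <= expR 1 ^+ j * (j`!)%:R.
Proof.
elim: j => [|j IH]; first by rewrite !expr0 mul1r.
have E : (j.+2%:R : R) = j.+1%:R * (1 + j.+1%:R^-1).
  by rewrite mulrDr mulr1 divff ?pnatr_eq0 // natr1.
rewrite E exprMn factS natrM [expR 1 ^+ _]exprS.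
have -> : expR 1 * expR 1 ^+ j * (j.+1%:R * j`!%:R) = j.+1%:R * (expR 1 ^+ j * j`!%:R) * expR 1 :> R.
  ring.
rewrite ler_pM ?exprn_ge0 ?addr_ge0 ?invr_ge0 ?ler0n //.
  by rewrite exprS ler_wpM2l.
apply: le_trans (_ : expR (j.+1%:R^-1) ^+ j.+1 <= _).
  by rewrite lerXn2r ?nnegrE ?expR_ge0 ?addr_ge0 ?invr_ge0 ?ler0n ?expR_ge1Dx.
by rewrite -expRM_natl divff // pnatr_eq0.
Qed.

Lemma sum_geo_half (R : realType) (r : R) N : 0 <= r <= 2^-1 -> \sum_(j < N) r ^+ j <= 2.
Proof.
move=> /andP[r0 r2]; suff : \sum_(j < N) r ^+ j <= 2 - 2 * r ^+ N.
  move/le_trans; apply; have := exprn_ge0 N r0; lra.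
elim: N => [|N IH]; first by rewrite big_ord0 expr0; lra.
rewrite big_ord_recr /= exprS; have := exprn_ge0 N r0; move: IH; nra.
Qed.

(** With ['C(n, j) <= n ^ j / j!] and [natSX_le_fact], the sets of size [j] contribute at most
    [(x * expR 1) ^+ j], a term of a geometric series. *)
Lemma sum_subsets_le (R : realType) n (x : R) : (0 < n)%N -> 0 <= x -> x * expR 1 <= 2^-1 ->
  \sum_(J : {set 'I_n}) (x / n%:R * #|J|.+1%:R) ^+ #|J| <= 2.
Proof.
move=> n0 x0 xe; have nR : 0 < n%:R :> R by rewrite ltr0n.
have cJ (J : {set 'I_n}) : (#|J| < n.+1)%N.
  by rewrite ltnS; have := max_card (mem J); rewrite card_ord.
rewrite (partition_big (fun J : {set 'I_n} => Ordinal (cJ J)) predT) //=.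
apply: le_trans (_ : \sum_(j < n.+1) (x * expR 1) ^+ j <= _); last first.
  by apply: sum_geo_half; rewrite xe mulr_ge0 ?expR_ge0.
apply: ler_sum => j _.
rewrite (eq_bigr (fun=> (x / n%:R * j.+1%:R) ^+ j)); last first.
  by move=> J /eqP <-.
rewrite sumr_const -[leLHS]mulr_natl.
have -> : #|[pred J : {set 'I_n} | Ordinal (cJ J) == j]| = 'C(n, j).
  transitivity #|[set J : {set 'I_n} | #|J| == j :> nat]|; last by rewrite card_draws card_ord.
  by apply: eq_card => J; rewrite !inE -val_eqE.
have j0 : 0 < (j`!)%:R :> R by rewrite ltr0n fact_gt0.
have Cn : 'C(n, j)%:R <= n%:R ^+ j / (j`!)%:R :> R.
  rewrite ler_pdivlMr // -natrM -natrX ler_nat bin_ffact.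
  elim: (nat_of_ord j) => // k IH; by rewrite ffactnSr expnSr leq_mul ?leq_subr.
apply: le_trans (_ : n%:R ^+ j / (j`!)%:R * ((x / n%:R) ^+ j * (expR 1 ^+ j * (j`!)%:R)) <= _).
  rewrite exprMn ler_pM ?ler0n ?mulr_ge0 ?exprn_ge0 ?divr_ge0 ?ler0n //.
  by rewrite ler_wpM2l ?exprn_ge0 ?divr_ge0 ?ler0n // natSX_le_fact.
rewrite le_eqVlt; apply/orP; left; apply/eqP; rewrite expr_div_n exprMn; field.
by rewrite expf_neq0 ?gt_eqF.
Qed.

(** A moved vertex costs [x / n] on average: [eps] for itself, [p * kap] for the edge to its parent
    and [c] for the other pairs. The factor [c] outside belongs to the root. *)
Lemma expect_tree_sum (R : realType) n (d eps kap : R) (v : 'I_n) :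
  (0 < n)%N -> 0 <= d <= n%:R -> 1 <= kap -> 0 <= eps ->
  eps * d * kap * expR (d * (kap - 1)) * expR 1 <= 2^-1 ->
  \sum_(G : graph n) Gnp_mass (d / n%:R) G * tree_sum eps kap G v
    <= 2 * expR (d * (kap - 1)).
Proof.
move=> n0 /andP[d0 dn] kap1 eps0 small; have nR : 0 < n%:R :> R by rewrite ltr0n.
set p := d / n%:R; set c := expR (d * (kap - 1)).
have p0 : 0 <= p by rewrite divr_ge0.
have p1 : p <= 1 by rewrite ler_pdivrMr ?mul1r.
have kap0 : 0 <= kap by apply: le_trans kap1.
have c0 : 0 <= c by apply: expR_ge0.
pose x := eps * d * kap * c.
have x0 : 0 <= x by rewrite /x !mulr_ge0.
apply: le_trans (_ : \sum_(pi | forest [set v] ([set: 'I_n] :\ v) pi)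
    c * (x / n%:R) ^+ #|moved pi| <= _);
  last first.
  rewrite -mulr_sumr mulrC ler_wpM2r //.
  by apply: le_trans (sum_forests_le _ _ _) (sum_subsets_le n0 x0 small); rewrite divr_ge0.
have E (G : graph n) : Gnp_mass p G * tree_sum eps kap G v =
    \sum_(pi | forest [set v] ([set: 'I_n] :\ v) pi) eps ^+ #|moved pi| *
      (Gnp_mass p G * ((runs_in G pi)%:R * kap ^+ #|edges_in G (v |: moved pi)|)).
  rewrite /tree_sum -setTD big_mkcondr mulr_sumr; apply: eq_bigr => pi _.
  by case: ifP => _; [rewrite mul1r mulrCA mulrA | rewrite mul0r !mulr0].
under eq_bigr do rewrite E.
rewrite exchange_big; apply: ler_sum => pi F /=.
rewrite -mulr_sumr; apply: le_trans (ler_wpM2l (exprn_ge0 _ eps0) (forest_expect p0 p1 kap1 F)) _.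
have -> : p * (kap - 1) * n%:R = d * (kap - 1) by rewrite /p; field; rewrite gt_eqF.
have -> : x / n%:R = eps * (p * kap) * c by rewrite /x /p; ring.
by rewrite -/c exprS !exprMn le_eqVlt; apply/orP; left; apply/eqP; ring.
Qed.

(** * Polynomial mixing *)

Section WeakModels.
Variables (R : realType) (M : soft_model R) (H : R).
Hypothesis normM : model_norm M <= H.

Lemma activity_le_norm (x : state M) : `|activity x| <= H.
Proof.
apply: le_trans normM; rewrite /model_norm le_max.
by rewrite (le_bigmax _ (fun x => `|activity x|)).
Qed.

Lemma interaction_le_norm (x y : state M) : `|interaction x y| <= H.
Proof.
apply: le_trans normM; rewrite /model_norm le_max; apply/orP; right.
apply: le_trans (le_bigmax _ _ x).
exact: (le_bigmax _ (fun y => `|interaction x y|)).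
Qed.

Variables (n : nat) (G : graph n).

Lemma card_graph_le : (#|G| <= n * n)%N.
Proof.
have := card_inside [set: 'I_n]; rewrite cardsT card_ord; apply: leq_trans.
by apply: subset_leq_card; apply/subsetP => e _; rewrite !inE.
Qed.

Hypothesis n_gt0 : (0 < n)%N.
Hypothesis H_le : H <= 2^-1.

Lemma hamiltonian_norm_le (s : config M n) : `|hamiltonian G s| <= n%:R ^+ 2.
Proof.
have H0 : 0 <= H.
  case: n n_gt0 s => // n' _ s; exact: le_trans (normr_ge0 _) (activity_le_norm (s ord0)).
apply: le_trans (ler_normD _ _) _.
apply: le_trans (_ : n%:R * H + (n * n)%:R * H <= _); last first.
  have : (n <= n * n)%N by rewrite leq_pmull.
  rewrite -(ler_nat R) natrM -expr2 => nn.
  have := ler0n R n; move: H0 H_le nn; nra.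
apply: lerD; apply: le_trans (ler_norm_sum _ _ _) _.
  rewrite -sum_const_ord; apply: ler_sum => i _; exact: activity_le_norm.
apply: le_trans (_ : \sum_(e in G) H <= _).
  by apply: ler_sum => e _; apply: interaction_le_norm.
by rewrite sumr_const -[leLHS]mulr_natl ler_wpM2r // ler_nat card_graph_le.
Qed.

(** This crude bound is enough, since only its logarithm enters the mixing time. *)
Lemma cmass_model_weight_le (s : config M n) :
  cmass (model_weight G) set0 s <=
    expR (n%:R * #|state M|%:R + 2 * n%:R ^+ 2) * model_weight G s.
Proof.
apply: le_trans (_ : \sum_(t : config M n) expR (2 * n%:R ^+ 2) * model_weight G s <= _).
  rewrite /cmass (eq_bigl predT) => [|t]; last exact: agree0.
  apply: ler_sum => t _; rewrite !model_weightE -expRD ler_expR.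
  have := hamiltonian_norm_le s; have := hamiltonian_norm_le t.
  by rewrite !ler_norml => /andP[_ a1] /andP[a2 _]; lra.
have sw := ltW (model_weight_gt0 G s).
have cE : #|config M n| = (#|state M| ^ n)%N by rewrite card_ffun card_ord.
rewrite sumr_const cE -[leLHS]mulr_natl expRD -mulrA ler_wpM2r ?(mulr_ge0 (expR_ge0 _) sw) //.
rewrite natrX expRM_natl lerXn2r ?nnegrE ?expR_ge0 //.
by have := expR_ge1Dx (#|state M|%:R : R); lra.
Qed.

End WeakModels.

Lemma expR_le_1B (R : realType) (x : R) : 0 <= x <= 2^-1 -> expR (- (2 * x)) <= 1 - x.
Proof.
move=> /andP[x0 x2]; rewrite expRN invf_ple ?posrE ?expR_gt0 //; last by lra.
apply: le_trans (_ : 1 + 2 * x <= _); last exact: expR_ge1Dx.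
rewrite -div1r ler_pdivrMr; first nra; lra.
Qed.

Lemma expR1_le4 (R : realType) : expR 1 <= 4 :> R.
Proof.
have h : 2^-1 <= expR (- 2^-1) :> R by apply: le_trans (expR_ge1Dx _); lra.
have h2 : expR 2^-1 <= 2 :> R.
  by rewrite -[leLHS]invrK -expRN -[leRHS]invrK lef_pV2 ?posrE ?invr_gt0 ?expR_gt0.
have -> : expR 1 = expR 2^-1 * expR 2^-1 :> R by rewrite -expRD; congr expR; lra.
have := expR_gt0 (2^-1 : R); nra.
Qed.

Lemma ln_sqr_le (R : realType) (x : R) : 144 <= x -> ln (x ^+ 2) + expR 1 <= x / 2.
Proof.
move=> x144; have x0 : 0 < x by lra.
rewrite lnXn // mulr2n -[in ln x](divfK (_ : 16 != 0) x) ?pnatr_eq0 //.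
rewrite lnM ?posrE ?divr_gt0 //.
(* Bounding [ln y] by [y] at [x / 16] and at [16] leaves [x / 8 + 36]. *)
have := @ln_sublinear R (x / 16); rewrite divr_gt0 // => /(_ isT).
have := @ln_sublinear R 16 (ltr0n _ 16); have := expR1_le4 R; lra.
Qed.

(** With [kap = expR 1] and [W = n ^ 2], the Poincare constant is [W * expR (2 * b * eta)], of order
    [n ^ (2 + 4 * b)]. The sampler adds a factor [n], and the logarithm of the inverse minimal
    probability a factor [n ^ 2]. *)
Lemma mixing_time_poly (R : realType) (M : soft_model R) (H eps : R) (b n : nat) (G : graph n) :
  (0 < n)%N -> 0 < H -> H <= 2^-1 -> 2 * H * expR 1 <= eps -> expR (- b%:R) <= eps ->
  model_norm M <= H -> ln (n%:R ^+ 2 : R) + expR 1 <= n%:R / 2 ->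
  (forall v, tree_sum eps (expR 1) G v <= n%:R ^+ 2) ->
  (mixing_time M G <=
    (n%:R ^+ (5 + 4 * b) * (expR (2 * b%:R * expR 1) * (#|state M|%:R + 4)) + 1)%:E)%E.
Proof.
move=> n0 H0 H2 Heps beps normM etan GW.
have n1 : 1 <= n%:R :> R by rewrite ler1n.
have nR : 0 < n%:R :> R by rewrite ltr0n.
set W : R := n%:R ^+ 2; set eta := ln W + expR 1.
have W1 : 1 <= W by rewrite exprn_ege1.
have W0 : 0 < W by apply: lt_le_trans W1.
have e1 : 1 <= expR 1 :> R by have := expR_ge1Dx (1 : R); lra.
have eta0 : 0 < eta by rewrite ltr_wpDl ?expR_gt0 // ln_ge0.
have mM : expR (- H) < expR H by rewrite ltr_expR; lra.
have ratio : expR (- H) / expR H = expR (- (2 * H)).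
  by rewrite -expRN -expRD; congr expR; ring.
have psib (x y : state M) : expR (- H) <= expR (interaction x y) <= expR H.
  by rewrite !ler_expR -ler_norml interaction_le_norm.
have kapb : expR H / expR (- H) <= expR 1.
  by rewrite -expRN -expRD ler_expR; lra.
have epsb : (1 - expR (- H) / expR H) * expR 1 <= eps.
  apply: le_trans Heps; rewrite ratio ler_wpM2r ?expR_ge0 //.
  have := expR_ge1Dx (- (2 * H)); lra.
pose K : R := W * expR (2 * b%:R * eta).
have K0 : 0 < K by rewrite mulr_gt0 ?expR_gt0.
have poinc (f : config M n -> R) :
    dv (model_weight G) set0 f <= K * \sum_v dv (model_weight G) [set~ v] f.
  have etan' : eta <= n%:R by apply: le_trans etan _; move: n1; lra.
  have := @global_poincare R n (state M) (fun _ x => expR (activity x))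
    (fun x y => expR (interaction x y)) _ _ _ _ _ (fun _ _ => expR_gt0 _) (expR_gt0 _)
    mM psib kapb e1 epsb beps G f W n0 W1 GW etan'.
  rewrite -/eta -/(model_weight G) => P.
  rewrite /K mulrAC -ler_pdivrMr ?expR_gt0 // -expRN mulrC; apply: le_trans P.
  rewrite ler_wpM2r ?dv_ge0 //; first by move=> s; apply: model_weight_gt0.
  have -> : - (2 * b%:R * eta) = (b * n)%:R * (- (2 * (eta / n%:R))).
    by rewrite natrM; field; rewrite gt_eqF.
  rewrite expRM_natl lerXn2r ?nnegrE ?expR_ge0 //.
    by rewrite subr_ge0 ler_pdivrMr // mul1r.
  apply: expR_le_1B; rewrite divr_ge0 ?(ltW eta0) ?(ltW nR) //= ler_pdivrMr //.
  by move: etan; rewrite -/W -/eta; lra.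
apply: (mixing_time_le n0 K0 poinc (cmass_model_weight_le normM G n0 H2)); last first.
  apply: mulr_ge0; first exact: exprn_ge0 (ltW nR).
  by apply: mulr_ge0; [exact: expR_ge0 | exact: addr_ge0].
have -> : K = n%:R ^+ (2 + 4 * b) * expR (2 * b%:R * expR 1).
  rewrite /K exprD -/W -[RHS]mulrA; congr (_ * _).
  have -> : 2 * b%:R * eta = (2 * b)%:R * ln W + 2 * b%:R * expR 1 by rewrite /eta natrM; ring.
  have -> : (4 * b = 2 * (2 * b))%N by rewrite mulnA.
  by rewrite expRD [expR (_%:R * ln W)]expRM_natl lnK ?posrE // [in RHS]exprM.
have -> : (5 + 4 * b = 1 + (2 + 4 * b) + 2)%N by rewrite addnAC.
rewrite [n%:R ^+ (_ + 2)]exprD [n%:R ^+ (1 + _)]exprD expr1 -/W.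
have -> : n%:R * n%:R ^+ (2 + 4 * b) * W * (expR (2 * b%:R * expR 1) * (#|state M|%:R + 4)) =
   n%:R * (n%:R ^+ (2 + 4 * b) * expR (2 * b%:R * expR 1)) * (W * (#|state M|%:R + 4)) by ring.
apply: ler_wpM2l.
  by apply: mulr_ge0; [exact: ltW | apply: mulr_ge0; [exact: exprn_ge0 (ltW nR) | exact: expR_ge0]].
have nW : n%:R <= W by rewrite /W expr2 ler_peMl.
have : n%:R * #|state M|%:R <= W * #|state M|%:R :> R by rewrite ler_wpM2r.
rewrite -/W mulrDr; move: W1; lra.
Qed.

Local Open Scope classical_set_scope.
Local Open Scope ring_scope.

Theorem theorem5 (R : realType) (d : R) (hd : 1 <= d) :
  exists Hstar : R, 0 < Hstar /\
    forall M : soft_model R, model_norm M <= Hstar ->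
      exists C K : R,
        (fun n : nat => Gnp_prob (d / n%:R)
           (fun G : graph n => (mixing_time M G <= (K * n%:R `^ C)%:E)%E))
          @ \oo --> (1 : R).
Proof.
have d0 : 0 < d by lra.
set c := expR (d * (expR 1 - 1)).
have e1 : 1 <= expR 1 :> R by have := expR_ge1Dx (1 : R); lra.
have c1 : 1 <= c by rewrite -expR0 ler_expR mulr_ge0 ?subr_ge0 // ltW.
pose X := d * expR 1 * c * expR 1.
have X1 : 1 <= X by rewrite !mulr_ege1.
have X0 : 0 < X by apply: lt_le_trans X1.
(* With [kap = expR 1], this turns the smallness condition of [expect_tree_sum] into an equality. *)
pose eps := (2 * X)^-1.
have eps0 : 0 < eps by rewrite invr_gt0 mulr_gt0.
have eps2 : eps <= 2^-1.
  by rewrite /eps lef_pV2 ?posrE ?mulr_gt0 //; move: X1; lra.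
(* For this [H], [2 * H * expR 1] equals [eps]. *)
exists (eps / (2 * expR 1)); split; first by rewrite divr_gt0 ?mulr_gt0 ?expR_gt0.
move=> M normM.
pose b := (Num.truncn (- ln eps)).+1.
have beps : expR (- b%:R) <= eps.
  by rewrite -[leRHS]lnK ?posrE // ler_expR lerNl ltW // truncnS_gt.
pose K : R := expR (2 * b%:R * expR 1) * (#|state M|%:R + 4) + 1.
exists (5 + 4 * b)%:R, K.
apply/cvgrPdist_le => e e0.
have H0 : 0 < eps / (2 * expR 1) by rewrite divr_gt0 ?mulr_gt0 ?expR_gt0.
(* The three thresholds serve [ln_sqr_le], the condition [d / n <= 1], and a failure probability
   below [e]. *)
pose N := maxn 144 (maxn (Num.truncn d).+1 (Num.truncn (2 * c / e)).+1).
exists N => // n /=; rewrite !geq_max => /and3P[n144 dn cn].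
have n0 : (0 < n)%N by apply: leq_trans n144.
have nR : 0 < n%:R :> R by rewrite ltr0n.
have {}dn : d <= n%:R by rewrite ltW // (lt_le_trans (truncnS_gt d)) // ler_nat.
have {}cn : 2 * c / e <= n%:R by rewrite ltW // (lt_le_trans (truncnS_gt _)) // ler_nat.
have p0 : 0 <= d / n%:R by rewrite divr_ge0 // ltW.
have p1 : d / n%:R <= 1 by rewrite ler_pdivrMr // mul1r.
rewrite ger0_norm ?subr_ge0 ?Gnp_prob_le1 //.
have E v : \sum_(G : graph n) Gnp_mass (d / n%:R) G * tree_sum eps (expR 1) G v <= 2 * c.
  apply: expect_tree_sum => //; rewrite ?(ltW eps0) ?(ltW d0) //.
  rewrite -/c (_ : eps * d * expR 1 * c * expR 1 = eps * X); last by rewrite /X; ring.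
  by rewrite /eps invfM -mulrA mulVf ?gt_eqF // mulr1.
have W0 : 0 < n%:R ^+ 2 :> R by rewrite exprn_gt0.
have Y0 v (G : graph n) : 0 <= tree_sum eps (expR 1) G v.
  by apply: sumr_ge0 => pi _; rewrite mulr_ge0 ?exprn_ge0 ?expR_ge0 // ltW.
have := Gnp_prob_all_le p0 p1 W0 Y0 E; rewrite card_ord => L.
have good : forall G : graph n, [forall v, tree_sum eps (expR 1) G v <= n%:R ^+ 2] ->
    (mixing_time M G <= (K * n%:R `^ (5 + 4 * b)%:R)%:E)%E.
  move=> G /forallP GW.
  apply: le_trans (mixing_time_poly n0 H0 _ _ beps normM _ GW) _.
  - apply: le_trans (_ : eps / 1 <= _); last by rewrite divr1.
    rewrite ler_pM2l // lef_pV2 ?posrE ?mulr_gt0 ?expR_gt0 //; move: e1; lra.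
  - rewrite (_ : 2 * _ * _ = eps) //; field.
    by rewrite gt_eqF ?expR_gt0.
  - by apply: ln_sqr_le; rewrite (ler_nat R 144).
  - rewrite lee_fin powR_mulrn ?ler0n // /K [leRHS]mulrDl mul1r lerD ?exprn_ege1 ?ler1n //.
    by rewrite mulrC.
have := Gnp_prob_mono p0 p1 good; move: L.
set P := Gnp_prob _ _; set Q := Gnp_prob _ _ => L PQ.
(* The union bound over [n] vertices against the threshold [n ^ 2] leaves a failure probability of
   [2 * c / n]. *)
have : n%:R * (2 * c) / n%:R ^+ 2 <= e; last by lra.
rewrite (_ : _ / _ = 2 * c / n%:R); last by field; rewrite gt_eqF.
by rewrite ler_pdivrMr // [leRHS]mulrC -ler_pdivrMr.
Qed.
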